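(* Let $N\ge1$, $f:[N]\to\{0,1\}$, and suppose we are given a quantum $\varepsilon$-biased oracle $O^{\varepsilon}_f$ for $f$, with no prior knowledge of the value of $\varepsilon$. Then there exists a quantum algorithm that outputs a number $\tilde\varepsilon_{\min}$ satisfying $\varepsilon_{\min}/(5\pi^2)\le\tilde\varepsilon_{\min}\le\varepsilon_{\min}$ with probability at least $2/3$, and whose query complexity is expected to be $O\!\left(\frac{\sqrt{N}\log N}{\varepsilon_{\min}}\log\log\frac{1}{\varepsilon_{\min}}\right)$.
   Context: A quantum oracle of a Boolean function $f:[N]\to\{0,1\}$ with bias $\varepsilon$ (an $\varepsilon$-biased oracle) is a unitary transformation $O^{\varepsilon}_f$ (queries may use $O^{\varepsilon}_f$ or its inverse) such that for every $x\in[N]$, $O^{\varepsilon}_f\ket{x}\ket{0^{m-1}}\ket{0}=\ket{x}\big(\alpha_x\ket{w_x}\ket{f(x)}+\beta_x\ket{w'_x}\ket{\overline{f(x)}}\big)$, where $\ket{w_x},\ket{w'_x}$ are normalized work-register states and $|\alpha_x|^2=1/2+\varepsilon_x\ge 1/2+\varepsilon$, with $0<\varepsilon$. Define $\varepsilon_{\min}=\min_x\varepsilon_x$ (so $0<\varepsilon\le\varepsilon_{\min}\le\varepsilon_x\le1/2$). The query complexity is the number of applications of the oracle or its inverse. *)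

(* Defs.v *)
From HB Require Import structures.
From mathcomp Require Import all_boot all_order all_algebra.
From mathcomp Require Import all_classical all_reals.
From mathcomp Require Import ereal sequences exp trigo.
From mathcomp Require Import complex.
Set Implicit Arguments. Unset Strict Implicit. Unset Printing Implicit Defensive.
Import Order.TTheory GRing.Theory Num.Theory.
Local Open Scope ring_scope.

Section QueryModel.
Variable R : realType.
Local Notation C := (complex R).

Definition csq (z : C) : R := (complex.Re z) ^+ 2 + (complex.Im z) ^+ 2.

(* Oracle register: |x> (x in [N]) , work register of m-1 = k qubits, answer qubit *)
Definition OT (N k : nat) : finType := ('I_N * 'I_(2 ^ k) * bool)%type.

Lemma pow2_gt0 (k : nat) : (0 < 2 ^ k)%N.
Proof. by rewrite expn_gt0. Qed.

Definition wzero (k : nat) : 'I_(2 ^ k) := Ordinal (pow2_gt0 k).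

(* a linear operator on C^T given by its matrix entries  U t s = <t|U|s> *)
Definition op (T : finType) := T -> T -> C.

Definition unitary (T : finType) (U : op T) : Prop :=
  forall i j : T, \sum_(t : T) conjc (U t i) * U t j = (i == j)%:R.

Definition normalized (T : finType) (v : T -> C) : Prop :=
  \sum_(t : T) csq (v t) = 1.

(* O is an eps-biased oracle for f : [N] -> {0,1}:
   O |x>|0^{m-1}>|0> = |x>(alpha_x |w_x>|f x> + beta_x |w'_x>|~f x>),
   with |alpha_x|^2 >= 1/2 + eps. *)
Definition biased_oracle (N k : nat) (f : 'I_N -> bool) (eps : R) (O : op (OT N k)) : Prop :=
  unitary O /\
  forall x : 'I_N, exists (alpha beta : C) (wx wx' : 'I_(2 ^ k) -> C),
    [/\ normalized wx, normalized wx',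
        (forall (y : 'I_N) (w : 'I_(2 ^ k)) (b : bool),
           O (y, w, b) (x, wzero k, false) =
             if y == x then alpha * wx w * (b == f x)%:R + beta * wx' w * (b == ~~ f x)%:R
             else 0)
      & 1 / 2 + eps <= csq alpha].

(* eps_x, defined by |alpha_x|^2 = 1/2 + eps_x, where |alpha_x|^2 is the squared norm of
   the component of O|x,0,0> with answer qubit f(x) *)
Definition eps_x (N k : nat) (f : 'I_N -> bool) (O : op (OT N k)) (x : 'I_N) : R :=
  (\sum_(w : 'I_(2 ^ k)) csq (O (x, w, f x) (x, wzero k, false))) - 1 / 2.

(* eps_min = min_x eps_x (N >= 1; all eps_x <= 1/2 < 1, so the identity 1 is harmless) *)
Definition eps_min (N k : nat) (f : 'I_N -> bool) (O : op (OT N k)) : R :=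
  \big[Num.min/1]_(x : 'I_N) eps_x f O x.

(* ---- Quantum query algorithms (hybrid quantum-classical model) ----
   A stage is a quantum circuit on the oracle register tensored with a workspace 'I_K,
   started in a computational basis state, made of arbitrary unitaries and applications
   of the oracle O or its inverse (acting on the oracle register), and ended by a
   measurement in the computational basis. An algorithm chooses, adaptively from the
   classical history of all previous measurement outcomes, either to halt with a real
   output or to run a further stage. *)
Definition ST (N k K : nat) : finType := (OT N k * 'I_K)%type.

Inductive gate (N k K : nat) : Type :=
| GUnitary of op (ST N k K)
| GQuery
| GQueryInv.

Record stage (N k : nat) : Type := Stage {
  sK : nat;
  sinit : ST N k sK;
  sgates : seq (gate N k sK) }.

Inductive action (N k : nat) : Type :=
| Halt of R
| Run of stage N k.

Definition algorithm (N k : nat) := seq nat -> action N k.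

Definition gate_ok (N k K : nat) (g : gate N k K) : Prop :=
  match g with GUnitary U => unitary U | _ => True end.

Definition algorithm_ok (N k : nat) (A : algorithm N k) : Prop :=
  forall h, match A h with
            | Halt _ => True
            | Run s => foldr (fun g P => gate_ok g /\ P) True (sgates s)
            end.

Definition apply_gate (N k K : nat) (O : op (OT N k)) (g : gate N k K)
  (psi : ST N k K -> C) : ST N k K -> C :=
  match g with
  | GUnitary U => fun t => \sum_(s : ST N k K) U t s * psi s
  | GQuery => fun t => \sum_(o : OT N k) O t.1 o * psi (o, t.2)
  | GQueryInv => fun t => \sum_(o : OT N k) conjc (O o t.1) * psi (o, t.2)
  end.

Definition stage_state (N k : nat) (O : op (OT N k)) (s : stage N k) : ST N k (sK s) -> C :=
  foldl (fun psi g => apply_gate O g psi)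
        (fun t => (t == sinit s)%:R) (sgates s).

Arguments stage_state {N k} O s _.

Definition is_query (N k K : nat) (g : gate N k K) : bool :=
  match g with GUnitary _ => false | _ => true end.

Definition stage_queries (N k : nat) (s : stage N k) : nat := count (@is_query N k (sK s)) (sgates s).

Fixpoint halt_prob (N k : nat) (A : algorithm N k) (O : op (OT N k)) (P : R -> bool)
  (n : nat) (h : seq nat) : R :=
  match A h with
  | Halt r => (P r)%:R
  | Run s => match n with
             | 0 => 0
             | n'.+1 => \sum_(t : ST N k (sK s))
                          csq (stage_state O s t) * halt_prob A O P n' (rcons h (enum_rank t))
             end
  end.

Fixpoint queries_upto (N k : nat) (A : algorithm N k) (O : op (OT N k))
  (n : nat) (h : seq nat) : R :=
  match n with
  | 0 => 0
  | n'.+1 => match A h with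
             | Halt _ => 0
             | Run s => (stage_queries s)%:R +
                        \sum_(t : ST N k (sK s))
                          csq (stage_state O s t) * queries_upto A O n' (rcons h (enum_rank t))
             end
  end.

Local Open Scope ereal_scope.
Definition success_prob (N k : nat) (A : algorithm N k) (O : op (OT N k)) (P : R -> bool)
  : \bar R := ereal_sup [set (halt_prob A O P n [::])%:E | n in [set: nat]].

Definition expected_queries (N k : nat) (A : algorithm N k) (O : op (OT N k)) : \bar R :=
  ereal_sup [set (queries_upto A O n [::])%:E | n in [set: nat]].
Local Close Scope ereal_scope.

End QueryModel.

(* Main.v *)
(** For each [x] let [s = P(bit 0) - P(bit 1)], so that [s^2 = 4 eps_x^2]. With
    [U = O^* Z O] and [Pi] the projector on the [|x,0,0>], the operator
    [Y = -(2Pi-1) U (2Pi-1) U] rotates the span of [|x,0,0>] and [U|x,0,0>]; its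
    eigenvalue [rot (s^2)] satisfies [|1 - rot|^2 = 4 s^2], hence is close to 1 exactly
    when [eps_x] is small. A control register in uniform superposition over
    [m < M = 2^j] drives [Y^m], and projecting it back on the uniform state succeeds with
    probability [|1/M sum rot^m|^2]: close to 1 if [M eps_x <= 1/10], at most 1/16 if
    [M eps_x >= 2]. A majority over [O(log N)] such registers pushes the second
    probability below [1/(16384 N)], so in the uniform superposition over [x] the flagged
    weight [p] is at least [1/(2N)] if some [eps_x] is small and negligible if none is.
    The two cases are told apart without amplitude estimation: the Grover iterate [G]
    started in [s] has [<s, G^t s> = Re (rot p)^t], whose average over [t < O(sqrt N)] is
    small in the first case and close to 1 in the second. This average is the amplitude of
    a single measurement outcome of a circuit with [O(2^j sqrt N log N)] queries.

    Classically, level [j = 0, 1, ...] takes the majority of [O(log j)] such tests and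
    stops with output [1/(10 2^j)] if it says that all [eps_x] are large. The number of
    tests makes the error probabilities summable over [j]; past the level where
    [2^j ~ 2/eps_min] each level is left with probability at most 1/16, which beats the
    doubling of the cost. Both facts are proved with supermartingales. *)
Require Import Defs.
From HB Require Import structures.
From mathcomp Require Import all_boot all_order all_algebra.
From mathcomp Require Import all_classical all_reals.
From mathcomp Require Import ereal sequences exp trigo.
From mathcomp Require Import normedtype derive.
From mathcomp Require Import complex.
From mathcomp Require Import ring lra zify.
Set Implicit Arguments. Unset Strict Implicit. Unset Printing Implicit Defensive.
Import Order.TTheory GRing.Theory Num.Theory.
Local Open Scope ring_scope.

(** * The rotation [rot p] *)

Section Rotation.
Variable R : realType.
Local Notation C := (complex R).
Implicit Types (z u : C) (p : R).

Lemma csqE z : (csq z)%:C%C = `|z| ^+ 2.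
Proof. by rewrite /csq add_Re2_Im2. Qed.

Lemma csq_conjM z : conjc z * z = (csq z)%:C%C.
Proof. by rewrite csqE sqr_normc mulrC. Qed.

Lemma conjcM z u : conjc (z * u) = conjc z * conjc u.
Proof. exact: rmorphM. Qed.

Lemma csq_ge0 z : 0 <= csq z.
Proof. by rewrite addr_ge0 ?sqr_ge0. Qed.

Lemma csqM z u : csq (z * u) = csq z * csq u.
Proof. by apply: complexI; rewrite rmorphM /= !csqE normrM exprMn. Qed.

Lemma csq_real (x : R) : csq x%:C%C = x ^+ 2.
Proof. by rewrite /csq /= expr0n addr0. Qed.

Lemma csq0 : csq (0 : C) = 0.
Proof. by rewrite (csq_real 0) expr0n. Qed.

Lemma csqX z n : csq (z ^+ n) = csq z ^+ n.
Proof.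
elim: n => [|n IH]; last by rewrite !exprS csqM IH.
by rewrite !expr0 (csq_real 1) expr1n.
Qed.

Lemma ReD z u : complex.Re (z + u) = complex.Re z + complex.Re u.
Proof. by case: z u => [? ?] [? ?]. Qed.

Lemma Re_sum (I : finType) (F : I -> C) :
  complex.Re (\sum_i F i) = \sum_i complex.Re (F i).
Proof. by apply: (big_morph _ ReD). Qed.

Lemma Re_realM (x : R) z : complex.Re (x%:C%C * z) = x * complex.Re z.
Proof. by case: z => a b /=; rewrite mul0r subr0. Qed.

Lemma csq_1B u : csq u = 1 -> csq (1 - u) = 2 - 2 * complex.Re u.
Proof. by case: u => a b; rewrite /csq /= => h; rewrite sub0r; lra. Qed.

Lemma csq_1_norm u : csq u = 1 -> `|u| = 1.
Proof.
by move=> h; apply/eqP; rewrite -sqrp_eq1 ?normr_ge0 // -csqE h.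
Qed.

(** Factor [1 - u ^+ k] as [1 - u] times a geometric sum of [k] unit terms. *)
Lemma csq_1BX u k : csq u = 1 -> csq (1 - u ^+ k) <= k%:R ^+ 2 * csq (1 - u).
Proof.
move=> h; rewrite -lecR rmorphM rmorphXn rmorph_nat /= !csqE -exprMn.
rewrite lerXn2r ?nnegrE ?normr_ge0 ?mulr_ge0 ?ler0n ?normr_ge0 //.
rewrite -[X in X - _](expr1n _ k) subrXX normrM mulrC.
rewrite ler_wpM2r ?normr_ge0 //; apply: le_trans (ler_norm_sum _ _ _) _.
rewrite (eq_bigr (fun=> 1)) => [|i _]; first by rewrite sumr_const card_ord.
by rewrite expr1n mul1r normrX (csq_1_norm h) expr1n.
Qed.

(** This is [e^(i theta)] with [p = sin^2 (theta / 2)], in algebraic form. *)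
Definition rot p : C := ((1 - 2 * p) +i* (2 * Num.sqrt (p * (1 - p))))%C.

Lemma sqr_sqrt_p p : 0 <= p <= 1 -> Num.sqrt (p * (1 - p)) ^+ 2 = p * (1 - p).
Proof. by move=> /andP[p0 p1]; rewrite sqr_sqrtr // mulr_ge0 ?subr_ge0. Qed.

Lemma csq_rot p : 0 <= p <= 1 -> csq (rot p) = 1.
Proof. by move=> h; rewrite /csq /= exprMn (sqr_sqrt_p h); ring. Qed.

Lemma csq_1Brot p : 0 <= p <= 1 -> csq (1 - rot p) = 4 * p.
Proof. by move=> h; rewrite csq_1B ?csq_rot //=; ring. Qed.

Lemma Re_rotX p k : 0 <= p <= 1 -> 1 - 2 * p * k%:R ^+ 2 <= complex.Re (rot p ^+ k).
Proof.
move=> h; have := @csq_1BX _ k (csq_rot h).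
by rewrite csq_1Brot // csq_1B ?csqX ?csq_rot ?expr1n //; lra.
Qed.

Lemma Re_csq_le z : csq z = 1 -> -1 <= complex.Re z <= 1.
Proof.
case: z => a b; rewrite /csq /= => h.
by have := sqr_ge0 b => hb; apply/andP; split; nra.
Qed.

(** Multiplied by [1 - rot p], of squared modulus [4 p], the geometric sum becomes [1 - rot p ^+ n],
    of squared modulus at most 4. *)
Lemma csq_sum_rot p n : 0 <= p <= 1 -> p * csq (\sum_(k < n) rot p ^+ k) <= 1.
Proof.
move=> h; have e : csq (1 - rot p ^+ n) <= 4.
  rewrite csq_1B ?csqX ?csq_rot ?expr1n //.
  have : csq (rot p ^+ n) = 1 by rewrite csqX csq_rot // expr1n.
  by move/Re_csq_le/andP=> [h1 h2]; lra.
have : csq (1 - rot p ^+ n) = csq (1 - rot p) * csq (\sum_(k < n) rot p ^+ k).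
  rewrite -csqM -[X in X - _ ^+ _](expr1n _ n) subrXX; congr (csq (_ * _)).
  by apply: eq_bigr => i _; rewrite expr1n mul1r.
by rewrite csq_1Brot // => h2; lra.
Qed.

(* [G^n s = a s + b B s] in [iter_two_reflections]; with [p = s^2] the iterates of the
   walk in [iter_walkF_spanS] have coordinates [a] and [s b]. *)
Fixpoint rotc p n : R * R :=
  if n is m.+1 then
    let: (a, b) := rotc p m in ((1 - 4 * p) * a - 2 * p * b, 2 * a + b)
  else (1, 0).

(** Change from the basis [s], [B s] to an orthonormal one: as [B] is a projector with
    [<s, B s> = p], the part of [B s] orthogonal to [s] has norm [sqrt (p (1 - p))]. *)
Lemma rotcE p n : 0 <= p <= 1 ->
  (rotc p n).1 + p * (rotc p n).2 = complex.Re (rot p ^+ n) /\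
  Num.sqrt (p * (1 - p)) * (rotc p n).2 = complex.Im (rot p ^+ n).
Proof.
move=> h; elim: n => [|n]; first by rewrite /= !mulr0 addr0.
rewrite exprS /=; case: (rotc p n) => a b /=; case: (rot p ^+ n) => x y /= [hx hy].
split; rewrite -hx -?hy; last by ring.
by have := sqr_sqrt_p h; set g := Num.sqrt _ => hg; ring: hg.
Qed.

End Rotation.

(** * Majority projector *)

Section Majority.
Variables (R : realType) (L M : nat).
Local Notation C := (complex R).
Local Notation J := {ffun 'I_L -> 'I_M}.
Local Notation B := {ffun 'I_L -> bool}.

Definition maj (b : B) : bool := (L <= 2 * \sum_i b i)%N.

(** Probability that at least half of [L] independent bits of bias [q] are true. *)
Definition majpoly (q : R) : R :=
  \sum_(b : B | maj b) \prod_i (if b i then q else 1 - q).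

(** Matrix of the projector on the uniform state of one register, or of its complement. *)
Definition unifproj (b : bool) (k l : 'I_M) : R :=
  if b then M%:R^-1 else (k == l)%:R - M%:R^-1.

Definition majproj (m m' : J) : R :=
  \sum_(b : B | maj b) \prod_i unifproj (b i) (m i) (m' i).

Definition wt (m : J) : nat := \sum_i m i.

Lemma wt_le (m : J) : (wt m <= L * M)%N.
Proof.
rewrite -[X in (_ <= X * _)%N]card_ord -sum_nat_const.
by apply: leq_sum => i _; apply: ltnW.
Qed.

Lemma sum_delta (T : finType) (V : pzSemiRingType) (a : T) (F : T -> V) :
  \sum_t (t == a)%:R * F t = F a.
Proof.
rewrite (bigD1 a) //= eqxx mul1r big1 ?addr0 // => t /negPf->.
by rewrite mul0r.
Qed.

Lemma sum_delta_sym (T : finType) (V : pzSemiRingType) (a : T) (F : T -> V) :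
  \sum_t (a == t)%:R * F t = F a.
Proof. by under eq_bigr do rewrite eq_sym; rewrite sum_delta. Qed.

Lemma unifproj_sym b k l : unifproj b k l = unifproj b l k.
Proof. by rewrite /unifproj eq_sym. Qed.

Lemma majproj_sym m m' : majproj m m' = majproj m' m.
Proof.
by apply: eq_bigr => b _; apply: eq_bigr => i _; rewrite unifproj_sym.
Qed.

Lemma unifproj_comp b b' k l : (0 < M)%N ->
  \sum_j unifproj b k j * unifproj b' j l = (b == b')%:R * unifproj b k l.
Proof.
move=> M0; have M0' : M%:R != 0 :> R by rewrite pnatr_eq0 -lt0n.
have s1 (c : R) : \sum_(j < M) c = M%:R * c.
  by rewrite sumr_const card_ord mulr_natl.
case: b b' => [] [] /=; rewrite /unifproj /= ?mul1r ?mul0r.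
- by rewrite s1; field.
- under eq_bigr do rewrite mulrBr mulrC.
  by rewrite sumrB sum_delta s1; field.
- under eq_bigr do rewrite mulrBl.
  by rewrite sumrB sum_delta_sym s1; field.
under eq_bigr do rewrite mulrBl mulrBr mulrBr.
rewrite sumrB sumrB sum_delta_sym sum_delta_sym sumrB s1.
under [X in _ - (X - _)]eq_bigr do rewrite mulrC.
by rewrite sum_delta; field.
Qed.

Lemma sum_prod_ffun2 (V : comPzRingType) (F : 'I_L -> 'I_M -> 'I_M -> V) :
  \sum_(m : J) \sum_(m' : J) \prod_i F i (m i) (m' i) =
  \prod_i \sum_k \sum_l F i k l.
Proof.
rewrite [RHS]bigA_distr_bigA; apply: eq_bigr => m _.
by rewrite [RHS]bigA_distr_bigA.
Qed.

(** For distinct [b] and [b'] the product vanishes, because some register carries a projector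
    against its complement. *)
Lemma majproj_idem m m' : (0 < M)%N ->
  \sum_j majproj m j * majproj j m' = majproj m m'.
Proof.
move=> M0; rewrite /majproj.
under eq_bigr do rewrite mulr_suml.
rewrite exchange_big /=; apply: eq_bigr => b mb.
under eq_bigr do rewrite mulr_sumr.
rewrite exchange_big /= (bigD1 b) //= [X in _ + X]big1 ?addr0 => [|b' /andP[_ bb']].
  under eq_bigr do rewrite -big_split /=.
  rewrite -(bigA_distr_bigA (fun i k => unifproj (b i) (m i) k * unifproj (b i) k (m' i))).
  by apply: eq_bigr => i _; rewrite unifproj_comp // eqxx mul1r.
under eq_bigr do rewrite -big_split /=.
rewrite -(bigA_distr_bigA (fun i k => unifproj (b i) (m i) k * unifproj (b' i) k (m' i))).
have /existsP[i bi] : [exists i, b i != b' i].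
  apply: contraR bb'; rewrite negb_exists => /forallP h; apply/eqP/ffunP => i.
  by apply/esym/eqP; rewrite -[_ == _]negbK.
by rewrite (bigD1 i) //= unifproj_comp // (negPf bi) !mul0r.
Qed.

(** The vector of powers of [z] has squared norm [M], and [q] is the fraction of it that lies on the
    uniform state. *)
Lemma unifproj_form b (z : C) : (0 < M)%N -> csq z = 1 ->
  let q := csq (\sum_(k < M) z ^+ k) / M%:R ^+ 2 in
  \sum_k \sum_l (unifproj b k l)%:C%C * (conjc (z ^+ k) * z ^+ l) =
  (M%:R * (if b then q else 1 - q))%:C%C.
Proof.
move=> M0 z1; have M0' : M%:R != 0 :> R by rewrite pnatr_eq0 -lt0n.
have ht : \sum_k \sum_l (unifproj true k l)%:C%C * (conjc (z ^+ k) * z ^+ l) =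
    (csq (\sum_(k < M) z ^+ k) / M%:R)%:C%C.
  rewrite /unifproj; under eq_bigr do rewrite -mulr_sumr -mulr_sumr.
  rewrite -mulr_sumr -mulr_suml -rmorph_sum /= csq_conjM.
  by rewrite mulrC -rmorphM.
case: b => /=; first by rewrite ht; congr (_ %:C)%C; field.
transitivity ((\sum_(k < M) 1)%:C%C - (csq (\sum_(k < M) z ^+ k) / M%:R)%:C%C : C); last first.
  by rewrite -rmorphB /= sumr_const card_ord; congr (_ %:C)%C; field.
rewrite -ht rmorph_sum -sumrB /=; apply: eq_bigr => k _.
under eq_bigr => l _ do rewrite rmorphB rmorph_nat mulrBl.
by rewrite sumrB sum_delta_sym csq_conjM csqX z1 expr1n.
Qed.

(** As [z ^+ wt m] is a product over the registers, the vector is a tensor power and the form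
    factors into values of [unifproj_form]. *)
Lemma majproj_form (z : C) : (0 < M)%N -> csq z = 1 ->
  \sum_m \sum_m' (majproj m m')%:C%C * (conjc (z ^+ wt m) * z ^+ wt m') =
  (M%:R ^+ L * majpoly (csq (\sum_(k < M) z ^+ k) / M%:R ^+ 2))%:C%C.
Proof.
move=> M0 z1; rewrite /majproj /majpoly.
under eq_bigr do (under eq_bigr do rewrite rmorph_sum /= mulr_suml).
under eq_bigr do rewrite exchange_big /=.
rewrite exchange_big /= mulr_sumr rmorph_sum /=; apply: eq_bigr => b _.
transitivity (\prod_(i < L) \sum_k \sum_l
    (unifproj (b i) k l)%:C%C * (conjc (z ^+ k) * z ^+ l)).
  rewrite -sum_prod_ffun2; apply: eq_bigr => m _; apply: eq_bigr => m' _.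
  rewrite rmorph_prod /= big_split /=; congr (_ * _).
  rewrite big_split /= -rmorph_prod /= /wt.
  by rewrite !(big_morph (fun n => z ^+ n) (exprD z) (expr0 z)).
rewrite (eq_bigr (fun i => (M%:R * (if b i then csq (\sum_(k < M) z ^+ k) / M%:R ^+ 2 else 1 - csq (\sum_(k < M) z ^+ k) / M%:R ^+ 2))%:C%C)) => [|i _]; last exact: unifproj_form.
by rewrite -rmorph_prod /= big_split /= prodr_const card_ord.
Qed.

(** The product is [z] to the power #true - #false, which a majority makes nonnegative. *)
Lemma prod_bool_le (b : B) (z : R) : 1 <= z -> maj b ->
  1 <= \prod_i (if b i then z else z^-1).
Proof.
move=> z1 mb; have z0 : 0 < z by lra.
rewrite (eq_bigr (fun i => z ^+ b i * z^-1 ^+ ~~ b i)); last first.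
  by move=> i _; case: (b i); rewrite ?expr0 ?expr1 ?mulr1 ?mul1r.
rewrite big_split /= -!(big_morph _ (exprD _) (expr0 _)).
have e : (\sum_i ~~ b i = L - \sum_i b i)%N.
  apply/esym/eqP; rewrite -(eqn_add2r (\sum_i b i)%N) subnK.
    rewrite -big_split /= (eq_bigr (fun=> 1%N)) => [|i _]; last by case: (b i).
    by rewrite sum1_card card_ord.
  rewrite -[X in (_ <= X)%N]card_ord -sum1_card.
  by apply: leq_sum => i _; case: (b i).
rewrite e exprVn ler_pdivlMr ?exprn_gt0 // mul1r ler_weXn2l //.
by rewrite leq_subLR addnn -mul2n.
Qed.

Lemma prod_bool_total (x y : R) :
  \sum_(b : B) \prod_i (if b i then x else y) = (x + y) ^+ L.
Proof.
rewrite -(bigA_distr_bigA (fun i (c : bool) => if c then x else y)).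
by under eq_bigr do rewrite big_bool; rewrite prodr_const card_ord.
Qed.

Lemma prod_bool_ge0 (b : B) (x y : R) : 0 <= x -> 0 <= y ->
  0 <= \prod_i (if b i then x else y).
Proof. by move=> x0 y0; apply: prodr_ge0 => i _; case: (b i). Qed.

Lemma majpoly_bounds q : 0 <= q <= 1 -> 0 <= majpoly q <= 1.
Proof.
move=> /andP[q0 q1]; apply/andP; split.
  by apply: sumr_ge0 => b _; apply: prod_bool_ge0; lra.
rewrite -[leRHS](expr1n _ L) -[X in _ <= X ^+ _](subrKC q) -prod_bool_total.
rewrite [leRHS](bigID maj) /= lerDl.
by apply: sumr_ge0 => b _; apply: prod_bool_ge0; lra.
Qed.

(* Chernoff bounds: multiply the summands by z^(#true - #false). *)
Lemma majpoly_le q z : 0 <= q <= 1 -> 1 <= z ->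
  majpoly q <= (q * z + (1 - q) / z) ^+ L.
Proof.
move=> /andP[q0 q1] z1; have z0 : 0 < z by lra.
rewrite -prod_bool_total [leRHS](bigID maj) /=; apply: ler_wpDr.
  apply: sumr_ge0 => b _; apply: prod_bool_ge0; first by apply: mulr_ge0; lra.
  by apply: divr_ge0; lra.
apply: ler_sum => b mb.
rewrite [leRHS](eq_bigr (fun i => (if b i then q else 1 - q) * (if b i then z else z^-1))) ?big_split /=.
  by rewrite ler_peMr ?prod_bool_ge0 ?subr_ge0 // prod_bool_le.
by move=> i _; case: (b i).
Qed.

Lemma majpoly_ge q z : 0 <= q <= 1 -> 1 <= z ->
  1 - ((1 - q) * z + q / z) ^+ L <= majpoly q.
Proof.
move=> /andP[q0 q1] z1; have z0 : 0 < z by lra.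
rewrite lerBlDr -[leLHS](expr1n _ L) -[X in X ^+ _ <= _](subrKC q).
rewrite -prod_bool_total [leLHS](bigID maj) /= lerD2l.
rewrite [X in _ <= X ^+ _]addrC -prod_bool_total [leRHS](bigID maj) /=; apply: ler_wpDl.
  by apply: sumr_ge0 => b _; apply: prod_bool_ge0; rewrite ?divr_ge0 ?mulr_ge0 //; lra.
apply: ler_sum => b mb.
rewrite [leRHS](eq_bigr (fun i => (if b i then q else 1 - q) * (if b i then z^-1 else z))) ?big_split /=.
  rewrite ler_peMr ?prod_bool_ge0 ?subr_ge0 //.
  (* Without a majority of true bits, the negated bits have one. *)
  have := @prod_bool_le [ffun i => ~~ b i] z z1.
  under eq_bigr do rewrite ffunE if_neg.
  apply; rewrite /maj; under eq_bigr do rewrite ffunE.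
  have e : (\sum_i b i + \sum_i ~~ b i = L)%N.
    rewrite -big_split /= (eq_bigr (fun=> 1%N)) => [|i _]; last by case: (b i).
    by rewrite sum1_card card_ord.
  move: e mb; rewrite /maj -ltnNge.
  move: (\sum_i b i)%N (\sum_i ~~ b i)%N => u v <-.
  by rewrite !mul2n -!addnn ltn_add2l leq_add2r; apply: ltnW.
by move=> i _; case: (b i).
Qed.

End Majority.

(** * Linear operators on functions *)

Section InnerProduct.
Variable R : realType.
Local Notation C := (complex R).
Variable X : finType.
Implicit Types (u v : X -> C).

Definition ip u v : C := \sum_i conjc (u i) * v i.

Lemma ipC u v : ip u v = conjc (ip v u).
Proof.
rewrite /ip rmorph_sum; apply: eq_bigr => i _.
by rewrite rmorphM /= conjcK mulrC.
Qed.

Lemma ip_comb u v v' (a b : C) :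
  ip u (fun i => a * v i + b * v' i) = a * ip u v + b * ip u v'.
Proof.
rewrite /ip !mulr_sumr -big_split; apply: eq_bigr => i _ /=; ring.
Qed.

Lemma ipDr u v v' : ip u (fun i => v i + v' i) = ip u v + ip u v'.
Proof. by rewrite /ip -big_split; apply: eq_bigr => i _; rewrite mulrDr. Qed.

Lemma ipDl u u' v : ip (fun i => u i + u' i) v = ip u v + ip u' v.
Proof. by rewrite ipC ipDr rmorphD /= -!ipC. Qed.

Lemma ip_csq u : ip u u = (\sum_i csq (u i))%:C%C.
Proof. by rewrite /ip rmorph_sum; apply: eq_bigr => i _; rewrite csq_conjM. Qed.

Definition linop (F : (X -> C) -> (X -> C)) :=
  forall (a b : C) u v, F (fun i => a * u i + b * v i) = (fun i => a * F u i + b * F v i).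

Lemma linop_comp F F' : linop F -> linop F' -> linop (F \o F').
Proof. by move=> h h' a b u v /=; rewrite h' h. Qed.

Lemma linop_iter F n : linop F -> linop (iter n F).
Proof. by move=> h; elim: n => [|n IH] a b u v //=; rewrite IH h. Qed.

Definition mulop (A : op R X) (v : X -> C) : X -> C := fun t => \sum_s A t s * v s.

Definition adjop (A : op R X) : op R X := fun t s => conjc (A s t).

Lemma linop_mulop A : linop (mulop A).
Proof.
move=> a b u v; apply: funext => t; rewrite /mulop !mulr_sumr -big_split /=.
by apply: eq_bigr => s _; ring.
Qed.

Lemma ip_mulop A u v : ip (mulop A u) v = ip u (mulop (adjop A) v).
Proof.
rewrite /ip /mulop.
under eq_bigr do rewrite rmorph_sum mulr_suml.
rewrite exchange_big /=; apply: eq_bigr => i _.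
by rewrite mulr_sumr; apply: eq_bigr => j _; rewrite /adjop rmorphM /=; ring.
Qed.

Lemma mulop_comp A B u :
  mulop A (mulop B u) = mulop (fun i j => \sum_t A i t * B t j) u.
Proof.
apply: funext => i; rewrite /mulop.
under eq_bigr do rewrite mulr_sumr.
rewrite exchange_big /=; apply: eq_bigr => j _.
by rewrite mulr_suml; apply: eq_bigr => t _; rewrite mulrA.
Qed.

Lemma mulop_delta u : mulop (fun i j => (i == j)%:R) u = u.
Proof. by apply: funext => i; rewrite /mulop sum_delta_sym. Qed.

Lemma mulop_adjK A u : unitary A -> mulop (adjop A) (mulop A u) = u.
Proof.
move=> UA; rewrite mulop_comp -[RHS]mulop_delta; congr mulop.
by apply: funext => i; apply: funext => j; exact: UA.
Qed.

(* In finite dimension a left inverse is a right inverse. *)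
Lemma unitary_adj (A : op R X) : unitary A ->
  forall i j, \sum_t A i t * conjc (A j t) = (i == j)%:R.
Proof.
move=> UA i j.
pose mA : 'M[C]_#|X| := \matrix_(a, b) A (enum_val a) (enum_val b).
pose mB : 'M[C]_#|X| := \matrix_(a, b) conjc (A (enum_val b) (enum_val a)).
have sE (F : X -> C) : \sum_(a < #|X|) F (enum_val a) = \sum_x F x.
  rewrite (reindex (fun x : X => enum_rank x)) /=; last first.
    by exists enum_val => x _; rewrite ?enum_rankK ?enum_valK.
  by apply: eq_bigr => x _; rewrite enum_rankK.
have BA : mB *m mA = 1%:M.
  apply/matrixP => a b; rewrite !mxE.
  under eq_bigr do rewrite !mxE.
  rewrite (sE (fun t => conjc (A t (enum_val a)) * A t (enum_val b))) UA.
  by rewrite (inj_eq enum_val_inj).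
have /matrixP/(_ (enum_rank i) (enum_rank j)) := mulmx1C BA.
rewrite !mxE; under eq_bigr do rewrite !mxE !enum_rankK.
by rewrite (sE (fun t => A i t * conjc (A j t))) (inj_eq enum_rank_inj).
Qed.

Lemma mulopK_adj A u : unitary A -> mulop A (mulop (adjop A) u) = u.
Proof.
move=> UA; rewrite mulop_comp -[RHS]mulop_delta; congr mulop.
by apply: funext => i; apply: funext => j; exact: unitary_adj.
Qed.

Lemma ip_unitary A u v : unitary A -> ip (mulop A u) (mulop A v) = ip u v.
Proof. by move=> UA; rewrite ip_mulop mulop_adjK. Qed.

Lemma adjop_unitary (A : op R X) : unitary A -> unitary (adjop A).
Proof.
move=> UA i j; rewrite /adjop -(unitary_adj UA i j); apply: eq_bigr => t _.
by rewrite conjcK.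
Qed.

Definition dgop (c : X -> R) (v : X -> C) : X -> C := fun i => (c i)%:C%C * v i.

Lemma linop_dgop c : linop (dgop c).
Proof. by move=> a b u v; apply: funext => i; rewrite /dgop; ring. Qed.

Lemma dgopK c u : (forall i, c i * c i = 1) -> dgop c (dgop c u) = u.
Proof.
by move=> h; apply: funext => i; rewrite /dgop mulrA -rmorphM h mul1r.
Qed.

Lemma ip_dgop c u v : ip (dgop c u) v = ip u (dgop c v).
Proof.
apply: eq_bigr => i _; rewrite /dgop conjcM conjc_real; ring.
Qed.

(* [G] is the product of the reflections about [s] and about the range of the
   projector [B]; it acts on the span of [s] and [B s] as the rotation [rot p]. *)
Section TwoReflections.
Variables (B G : (X -> C) -> (X -> C)) (s : X -> C) (p : R).
Hypotheses (p01 : 0 <= p <= 1) (linB : linop B) (s1 : ip s s = 1) (sB : ip s (B s) = p%:C%C)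
  (BB : B (B s) = B s).
Hypothesis GE : forall u, G u =
  let v := fun i => 2 * B u i + (-1) * u i in fun i => v i + (- 2 * ip s v) * s i.

Lemma iter_two_reflections t : iter t G s =
  fun i => ((rotc p t).1)%:C%C * s i + ((rotc p t).2)%:C%C * B s i.
Proof.
elim: t => [|t /= ->].
  by apply: funext => i /=; rewrite mul0r addr0 mul1r.
case: (rotc p t) => a b /=; rewrite GE /= linB BB; apply: funext => i.
rewrite ip_comb !ip_comb s1 sB.
by ring.
Qed.

Lemma ip_iter_two_reflections t : ip s (iter t G s) = (complex.Re (rot p ^+ t))%:C%C.
Proof.
rewrite iter_two_reflections ip_comb s1 sB -(rotcE t p01).1.
by ring.
Qed.

End TwoReflections.

End InnerProduct.

(** * The walk operator of the oracle *)

Section Walk.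
Variables (R : realType) (N k : nat) (O : op R (OT N k)).
Local Notation C := (complex R).
Local Notation T := (OT N k).
Implicit Types (u v : T -> C) (al be : 'I_N -> R).

Definition isP (o : T) : bool := (o.1.2 == wzero k) && ~~ o.2.
Definition sgnZ (o : T) : R := if o.2 then -1 else 1.
Definition sgnP (o : T) : R := if isP o then 1 else -1.
Definition sgnN (o : T) : R := if isP o then -1 else 1.

Definition queryU u := mulop (adjop O) (dgop sgnZ (mulop O u)).
Definition walkF u := dgop sgnN (queryU (dgop sgnP (queryU u))).
Definition walkB u := queryU (dgop sgnP (queryU (dgop sgnN u))).

Definition basisE al : T -> C := fun o => if isP o then (al o.1.1)%:C%C else 0.
(** Coordinates in the planes of [|x,0,0>] and [U|x,0,0>], for all [x] at once. These two generators
    are not orthogonal: their inner product is [s x]. *)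
Definition spanS al be : T -> C := fun o => basisE al o + queryU (basisE be) o.

Lemma linop_queryU : linop queryU.
Proof.
apply: (linop_comp (F' := dgop sgnZ \o mulop O)); first exact: linop_mulop.
by apply: linop_comp; [exact: linop_dgop | exact: linop_mulop].
Qed.

Lemma linop_walkF : linop walkF.
Proof. by move=> a b u v; rewrite /walkF linop_queryU linop_dgop linop_queryU linop_dgop. Qed.

Lemma linop_walkB : linop walkB.
Proof. by move=> a b u v; rewrite /walkB linop_dgop linop_queryU linop_dgop linop_queryU. Qed.

Lemma sgnZK o : sgnZ o * sgnZ o = 1.
Proof. by rewrite /sgnZ; case: ifP; rewrite ?mulrNN mulr1. Qed.
Lemma sgnPK o : sgnP o * sgnP o = 1.
Proof. by rewrite /sgnP; case: ifP; rewrite ?mulrNN mulr1. Qed.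
Lemma sgnNK o : sgnN o * sgnN o = 1.
Proof. by rewrite /sgnN; case: ifP; rewrite ?mulrNN mulr1. Qed.

Hypothesis UO : unitary O.

Lemma queryUK u : queryU (queryU u) = u.
Proof. by rewrite /queryU mulopK_adj // dgopK ?mulop_adjK //; exact: sgnZK. Qed.

Lemma ip_queryU u v : ip (queryU u) v = ip u (queryU v).
Proof.
rewrite /queryU ip_mulop ip_dgop ip_mulop; congr (ip _ (mulop _ (dgop _ (mulop _ _)))).
by apply: funext => i; apply: funext => j; rewrite /adjop conjcK.
Qed.

Lemma walkFK u : walkB (walkF u) = u.
Proof.
rewrite /walkB /walkF dgopK; last exact: sgnNK.
by rewrite queryUK dgopK ?queryUK //; exact: sgnPK.
Qed.

Lemma walkBK u : walkF (walkB u) = u.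
Proof.
rewrite /walkB /walkF queryUK dgopK; last exact: sgnPK.
by rewrite queryUK dgopK //; exact: sgnNK.
Qed.

Lemma ip_walkF u v : ip (walkF u) v = ip u (walkB v).
Proof. by rewrite /walkF /walkB ip_dgop ip_queryU ip_dgop ip_queryU. Qed.

Lemma iter_walkFK n u : iter n walkB (iter n walkF u) = u.
Proof. by elim: n u => [//|n IH] u; rewrite iterSr /= walkFK IH. Qed.

Lemma iter_walkBK n u : iter n walkF (iter n walkB u) = u.
Proof. by elim: n u => [//|n IH] u; rewrite iterSr /= walkBK IH. Qed.

Lemma ip_iter_walkF n u v : ip (iter n walkF u) v = ip u (iter n walkB v).
Proof. by elim: n u v => [//|n IH] u v; rewrite iterS ip_walkF IH -iterSr. Qed.

Variable s : 'I_N -> R.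
(** Compressed to the states [|x,0,0>], [U] is diagonal with entries [s x]; [queryU_oracle]
    establishes this for a biased oracle. *)
Hypothesis Us : forall be o, isP o -> queryU (basisE be) o = (s o.1.1 * be o.1.1)%:C%C.

Lemma basisEN be : basisE (fun x => - be x) = (fun o => (-1) * basisE be o + 0 * basisE be o).
Proof.
by apply: funext => o; rewrite /basisE; case: ifP => _; rewrite ?rmorphN; ring.
Qed.

Lemma queryU_spanS al be : queryU (spanS al be) = spanS be al.
Proof.
rewrite /spanS -[X in queryU X](_ : (fun o => 1 * basisE al o + 1 * queryU (basisE be) o) = _).
  by rewrite linop_queryU queryUK; apply: funext => o; rewrite !mul1r addrC.
by apply: funext => o; rewrite !mul1r.
Qed.

(** The reflection [2 Pi - 1] fixes [|x,0,0>] and, by [Us], sends [U|x,0,0>] to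
    [2 s x |x,0,0> - U|x,0,0>]. *)
Lemma sgnP_spanS al be :
  dgop sgnP (spanS al be) = spanS (fun x => al x + 2 * s x * be x) (fun x => - be x).
Proof.
rewrite /spanS basisEN linop_queryU; apply: funext => o; rewrite /dgop /sgnP /basisE.
by case: ifP => Po; [rewrite !Us //; ring | ring].
Qed.

Lemma walkF_spanS al be : walkF (spanS al be) =
  spanS (fun x => (1 - 4 * s x ^+ 2) * al x - 2 * s x * be x) (fun x => be x + 2 * s x * al x).
Proof.
rewrite /walkF queryU_spanS sgnP_spanS queryU_spanS.
have -> (w : T -> C) : dgop sgnN w = dgop (fun=> -1) (dgop sgnP w).
  apply: funext => o; rewrite /dgop /sgnN /sgnP; case: ifP => _; ring.
rewrite sgnP_spanS.
rewrite /spanS -[X in _ = fun o => X o + _](_ : (fun o => (-1) * basisE (fun x => - al x + 2 * s x * (be x + 2 * s x * al x)) o + 0 * 0) = _); last first.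
  apply: funext => o; rewrite /basisE; case: ifP => _; ring.
by rewrite basisEN linop_queryU; apply: funext => o; rewrite /dgop; ring.
Qed.

(** With the second coordinate written as [s x] times [b], the recurrence of [walkF_spanS] is the
    one defining [rotc]. *)
Lemma iter_walkF_spanS (a : R) n :
  iter n walkF (basisE (fun=> a)) =
  spanS (fun x => a * (rotc (s x ^+ 2) n).1) (fun x => a * (s x * (rotc (s x ^+ 2) n).2)).
Proof.
elim: n => [|n IH] /=.
  rewrite mulr1 /spanS; apply: funext => o.
  rewrite -[X in _ + queryU X o](_ : (fun o => 0 * basisE (fun=> 0) o + 0 * basisE (fun=> 0) o) = _).
    by rewrite linop_queryU !mul0r !addr0.
  by apply: funext => o'; rewrite /basisE !mul0r addr0; case: ifP => _; rewrite ?mulr0.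
rewrite IH walkF_spanS; congr spanS; apply: funext => x;
  case: (rotc _ n) => c d /=; ring.
Qed.

Lemma sum_isP (V : nmodType) (F : 'I_N -> V) :
  \sum_(o : T) (if isP o then F o.1.1 else 0) = \sum_x F x.
Proof.
rewrite -big_mkcond (reindex_onto (fun x => (x, wzero k, false)) (fun o : T => o.1.1)) /=.
  by apply: eq_bigl => x; rewrite /isP /= !eqxx.
by move=> [[x w] b]; rewrite /isP /= => /andP[/eqP -> /negPf ->].
Qed.

Lemma ip_basisE al u : ip (basisE al) u = \sum_x (al x)%:C%C * u (x, wzero k, false).
Proof.
rewrite -sum_isP /ip; apply: eq_bigr => o _; rewrite /basisE.
case: ifP => Po; last by rewrite conjc0 mul0r.
rewrite conjc_real; congr (_ * u _).
by move: o Po => [[x w] b]; rewrite /isP /= => /andP[/eqP -> /negPf ->].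
Qed.

Lemma ip_spanS al be al' be' :
  ip (spanS al be) (spanS al' be') =
  (\sum_x (al x * al' x + be x * be' x + s x * (al x * be' x + be x * al' x)))%:C%C.
Proof.
have EE a b : ip (basisE a) (basisE b) = (\sum_x a x * b x)%:C%C.
  rewrite ip_basisE rmorph_sum; apply: eq_bigr => x _ /=.
  by rewrite /basisE /isP /= ?eqxx rmorphM.
have EU a b : ip (basisE a) (queryU (basisE b)) = (\sum_x s x * (a x * b x))%:C%C.
  rewrite ip_basisE rmorph_sum; apply: eq_bigr => x _ /=.
  by rewrite Us /isP /= ?eqxx //; ring.
rewrite /spanS ipDl !ipDr EE EU !ip_queryU queryUK EE EU.
rewrite -!rmorphD /= -!big_split /=; congr (_ %:C)%C.
by apply: eq_bigr => x _; ring.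
Qed.

(** In each plane the [n]-th iterate is the planar vector [rot ^+ n], by [rotcE]; the real part of
    [conjc z * z'] is the inner product of planar vectors. *)
Lemma ip_iter_walkF_basis (a : R) n n' : (forall x, 0 <= s x ^+ 2 <= 1) ->
  ip (iter n walkF (basisE (fun=> a))) (iter n' walkF (basisE (fun=> a))) =
  (a ^+ 2 * \sum_x complex.Re (conjc (rot (s x ^+ 2) ^+ n) * rot (s x ^+ 2) ^+ n'))%:C%C.
Proof.
move=> s01; rewrite !iter_walkF_spanS ip_spanS mulr_sumr; congr (_ %:C)%C.
apply: eq_bigr => x _; have [h1 h2] := rotcE n (s01 x); have [h3 h4] := rotcE n' (s01 x).
case: (rot _ ^+ n) h1 h2 => u v /= <- <-; case: (rot _ ^+ n') h3 h4 => u' v' /= <- <-.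
by have := sqr_sqrt_p (s01 x); set g := Num.sqrt _ => hg; ring: hg.
Qed.

End Walk.

(** * Controlled walk and Grover iterate *)

Section Controlled.
Variables (R : realType) (N k : nat) (O : op R (OT N k)).
Variables (J : finType) (w : J -> nat) (Q : J -> J -> R) (a : R).
Local Notation C := (complex R).
Local Notation X := (OT N k * J)%type.
Implicit Types (u v : X -> C).

Definition ctlF u : X -> C := fun x => iter (w x.2) (walkF O) (fun o => u (o, x.2)) x.1.
Definition ctlB u : X -> C := fun x => iter (w x.2) (walkB O) (fun o => u (o, x.2)) x.1.
Definition projQ u : X -> C := fun x => \sum_m (Q x.2 m)%:C%C * u (x.1, m).
Definition startX : X -> C := fun x => basisE (fun=> a) x.1.
Definition goodB u := ctlB (projQ (ctlF u)).
Definition groverG u : X -> C :=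
  let v := fun i => 2 * goodB u i + (-1) * u i in
  fun i => v i + (- 2 * ip startX v) * startX i.

Lemma ip_pair u v : ip u v = \sum_m ip (fun o => u (o, m)) (fun o => v (o, m)).
Proof. by rewrite /ip exchange_big /= pair_bigA /=; apply: eq_bigr => -[]. Qed.

Lemma linop_ctlF : linop ctlF.
Proof.
move=> b c u v; apply: funext => x.
by rewrite /ctlF (linop_iter _ (@linop_walkF _ _ _ O) b c (fun o => u (o, x.2)) (fun o => v (o, x.2))).
Qed.

Lemma linop_ctlB : linop ctlB.
Proof.
move=> b c u v; apply: funext => x.
by rewrite /ctlB (linop_iter _ (@linop_walkB _ _ _ O) b c (fun o => u (o, x.2)) (fun o => v (o, x.2))).
Qed.

Lemma linop_projQ : linop projQ.
Proof.
move=> b c u v; apply: funext => x; rewrite /projQ !mulr_sumr -big_split /=.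
by apply: eq_bigr => m _; ring.
Qed.

Lemma linop_goodB : linop goodB.
Proof. by move=> b c u v; rewrite /goodB linop_ctlF linop_projQ linop_ctlB. Qed.

Lemma linop_groverG : linop groverG.
Proof.
move=> b c u v; apply: funext => x; rewrite /groverG linop_goodB.
by rewrite !ip_comb; ring.
Qed.

Hypothesis UO : unitary O.
Hypothesis Qidem : forall m m', \sum_j Q m j * Q j m' = Q m m'.

Lemma ctlFK u : ctlB (ctlF u) = u.
Proof. by apply: funext => -[o m]; rewrite /ctlB /ctlF /= iter_walkFK. Qed.

Lemma ctlBK u : ctlF (ctlB u) = u.
Proof. by apply: funext => -[o m]; rewrite /ctlB /ctlF /= iter_walkBK. Qed.

Lemma ip_ctlF u v : ip (ctlF u) v = ip u (ctlB v).
Proof. by rewrite !ip_pair; apply: eq_bigr => m _; rewrite /ctlB /ctlF /= ip_iter_walkF. Qed.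

Lemma projQK u : projQ (projQ u) = projQ u.
Proof.
apply: funext => x; rewrite /projQ /=.
under eq_bigr do rewrite mulr_sumr.
rewrite exchange_big /=; apply: eq_bigr => m _.
rewrite -(Qidem x.2 m) rmorph_sum mulr_suml; apply: eq_bigr => j _ /=.
by rewrite rmorphM mulrA.
Qed.

Lemma goodBK u : goodB (goodB u) = goodB u.
Proof. by rewrite /goodB ctlBK projQK. Qed.

Variable s : 'I_N -> R.
Hypothesis Us : forall be (o : OT N k), isP o -> queryU O (basisE be) o = (s o.1.1 * be o.1.1)%:C%C.
Hypothesis s01 : forall x, 0 <= s x ^+ 2 <= 1.
Hypothesis a1 : a ^+ 2 * (N%:R * #|J|%:R) = 1.

(** The flagged weight [<s, B s>] of the Grover start state [s = startX] for [B = goodB], as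
    computed in [ip_goodB]. *)
Definition goodp : R := a ^+ 2 * \sum_x complex.Re (\sum_m \sum_m'
   (Q m m')%:C%C * (conjc (rot (s x ^+ 2) ^+ w m) * rot (s x ^+ 2) ^+ w m')).

Lemma ip_startX : ip startX startX = 1.
Proof.
rewrite ip_pair /startX /=.
rewrite (eq_bigr (fun=> (a ^+ 2 * N%:R)%:C%C)) => [|m _].
  by rewrite sumr_const -rmorphMn /= -mulr_natr -mulrA a1.
have /= -> := @ip_iter_walkF_basis R N k O UO s Us a 0 0 s01.
rewrite (eq_bigr (fun=> 1)) => [|x _]; first by rewrite sumr_const card_ord.
by rewrite oppr0 mulr1 mulr0 subr0.
Qed.

Lemma ip_goodB : ip startX (goodB startX) = goodp%:C%C.
Proof.
rewrite /goodB -ip_ctlF ip_pair /goodp mulr_sumr rmorph_sum.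
under [RHS]eq_bigr do rewrite /= Re_sum mulr_sumr rmorph_sum.
rewrite [RHS]exchange_big /=; apply: eq_bigr => m _.
under [RHS]eq_bigr do rewrite /= Re_sum mulr_sumr rmorph_sum.
rewrite [RHS]exchange_big /= /projQ /= /ip.
under [LHS]eq_bigr do rewrite mulr_sumr.
rewrite [LHS]exchange_big /=; apply: eq_bigr => m' _.
transitivity ((Q m m')%:C%C * ip (iter (w m) (walkF O) (basisE (fun=> a)))
    (iter (w m') (walkF O) (basisE (fun=> a)))).
  by rewrite /ip mulr_sumr; apply: eq_bigr => o _; rewrite /ctlF /startX /=; ring.
rewrite (ip_iter_walkF_basis UO Us) // -rmorphM -rmorph_sum /=; congr (_ %:C)%C.
rewrite mulrA [X in X * _]mulrC -mulrA mulr_sumr mulr_sumr; apply: eq_bigr => x _.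
by rewrite Re_realM.
Qed.

Lemma ip_groverG t : 0 <= goodp <= 1 ->
  ip startX (iter t groverG startX) = (complex.Re (rot goodp ^+ t))%:C%C.
Proof.
move=> p01; apply: (ip_iter_two_reflections p01 linop_goodB ip_startX ip_goodB) => //.
exact: goodBK.
Qed.

End Controlled.

(** * The circuit of a test *)

Section Circuit.
Variables (R : realType) (N k : nat) (J : finType) (nT : nat).
Variables (w : J -> nat) (Q : J -> J -> R) (a b : R) (D : nat).
Local Notation C := (complex R).
Local Notation X := (OT N k * J)%type.
Local Notation K := #|{: J * 'I_nT}|.
Local Notation S := (ST N k K).
Local Notation gt := (gate R N k K).
Implicit Types (psi : S -> C).

Definition gates_ok (gs : seq gt) : Prop := foldr (fun g P => gate_ok g /\ P) True gs.

Lemma gates_ok_cat gs gs' : gates_ok gs -> gates_ok gs' -> gates_ok (gs ++ gs').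
Proof. by elim: gs => [//|g gs IH] /= [? ?] ?; split => //; apply: IH. Qed.

Definition run (O : op R (OT N k)) (gs : seq gt) psi : S -> C :=
  foldl (fun psi g => apply_gate O g psi) psi gs.

Lemma run_cons O g gs psi : run O (g :: gs) psi = run O gs (apply_gate O g psi).
Proof. by []. Qed.

Lemma run_nil O psi : run O [::] psi = psi.
Proof. by []. Qed.

Lemma run_cat O gs gs' psi : run O (gs ++ gs') psi = run O gs' (run O gs psi).
Proof. exact: foldl_cat. Qed.

(** All gates of the circuit other than queries are real symmetric involutions. *)
Lemma unitary_real (Y : finType) (H : Y -> Y -> R) : (forall i j, H i j = H j i) ->
  (forall i j, \sum_t H i t * H t j = (i == j)%:R) -> unitary (fun i j => (H i j)%:C%C).
Proof.
move=> Hs Hi i j; rewrite -(rmorph_nat (real_complex R)) -Hi rmorph_sum.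
by apply: eq_bigr => t _; rewrite conjc_real -rmorphM Hs.
Qed.

Definition blockop (H : 'I_nT -> X -> X -> R) (s s' : S) : R :=
  ((enum_val s.2).2 == (enum_val s'.2).2)%:R *
  H (enum_val s.2).2 (s.1, (enum_val s.2).1) (s'.1, (enum_val s'.2).1).

Definition bgate H : gt := GUnitary (fun s s' => (blockop H s s')%:C%C).

Definition slice psi (t : 'I_nT) : X -> C := fun x => psi (x.1, enum_rank (x.2, t)).

Lemma sum_ST (V : nmodType) (F : S -> V) :
  \sum_s F s = \sum_(t : 'I_nT) \sum_(x : X) F (x.1, enum_rank (x.2, t)).
Proof.
rewrite pair_bigA /= (reindex (fun p : 'I_nT * X => (p.2.1, enum_rank (p.2.2, p.1)))) //=.
exists (fun s : S => ((enum_val s.2).2, (s.1, (enum_val s.2).1))).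
  by move=> [t [o m]] _ /=; rewrite enum_rankK.
by move=> [o i] _ /=; rewrite -surjective_pairing enum_valK.
Qed.

Lemma blockop_rank H o o' m m' t t' :
  blockop H (o, enum_rank (m, t)) (o', enum_rank (m', t')) =
  (t == t')%:R * H t (o, m) (o', m').
Proof. by rewrite /blockop /= !enum_rankK. Qed.

Lemma slice_bgate O H psi t :
  slice (apply_gate O (bgate H) psi) t = mulop (fun x y => (H t x y)%:C%C) (slice psi t).
Proof.
apply: funext => -[o m]; rewrite /slice /= /mulop sum_ST /=.
rewrite (bigD1 t) //= [X in _ + X]big1 ?addr0 => [|t' /negPf tt'].
  apply: eq_bigr => -[o' m'] _ /=; by rewrite blockop_rank eqxx mul1r.
apply: big1 => -[o' m'] _ /=; by rewrite blockop_rank eq_sym tt' mul0r rmorph0 mul0r.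
Qed.

Lemma bgate_ok H : (forall t x y, H t x y = H t y x) ->
  (forall t x y, \sum_z H t x z * H t z y = (x == y)%:R) -> gate_ok (bgate H).
Proof.
move=> Hs Hi; apply: unitary_real => [i j|i j].
  by rewrite /blockop eq_sym; case: eqP => [->|]; rewrite ?mul0r // Hs.
case: i j => [o i] [o' i']; rewrite -(enum_valK i) -(enum_valK i').
case: (enum_val i) (enum_val i') => [m t] [m' t'].
rewrite sum_ST (bigD1 t) //= [X in _ + X]big1 ?addr0 => [|t'' /negPf tt'].
  under eq_bigr do rewrite !blockop_rank eqxx mul1r.
  have [->|tt'] := eqVneq t t'.
    under eq_bigr do rewrite mul1r -surjective_pairing.
    by rewrite Hi !xpair_eqE (inj_eq enum_rank_inj) xpair_eqE eqxx andbT.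
  under eq_bigr do rewrite mul0r mulr0.
  by rewrite big1 // xpair_eqE (inj_eq enum_rank_inj) xpair_eqE (negPf tt') !andbF.
by apply: big1 => -[? ?] _; rewrite !blockop_rank eq_sym tt' !mul0r.
Qed.

Definition dgate (c : J -> OT N k -> R) : gt :=
  bgate (fun _ x y => (x == y)%:R * c y.2 y.1).

Definition slice2 psi t m : OT N k -> C := fun o => slice psi t (o, m).

Lemma slice2_dgate O c psi t m :
  slice2 (apply_gate O (dgate c) psi) t m = dgop (c m) (slice2 psi t m).
Proof.
apply: funext => o; rewrite /slice2 slice_bgate /mulop /dgop.
under eq_bigr do rewrite rmorphM rmorph_nat -mulrA.
by rewrite sum_delta_sym.
Qed.

Lemma dgate_ok c : (forall m o, c m o * c m o = 1) -> gate_ok (dgate c).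
Proof.
move=> hc; apply: bgate_ok => [t x y|t x y].
  by rewrite eq_sym; case: eqP => [->|]; rewrite ?mul0r.
under eq_bigr do rewrite -mulrA; rewrite sum_delta_sym.
by case: eqP => [->|]; rewrite ?mul0r ?mulr0 // !mul1r hc.
Qed.

Lemma slice2_query O psi t m :
  slice2 (apply_gate O (@GQuery R N k K) psi) t m = mulop O (slice2 psi t m).
Proof. by []. Qed.

Lemma slice2_queryinv O psi t m :
  slice2 (apply_gate O (@GQueryInv R N k K) psi) t m = mulop (adjop O) (slice2 psi t m).
Proof. by []. Qed.

(* Only the diagonal gates are controlled: without them the queries of a step cancel. *)
Definition ctlsgn (sg : OT N k -> R) i (m : J) o : R := if (i < w m)%N then sg o else 1.

Definition fstep i : seq gt :=
  [:: @GQuery R N k K; dgate (ctlsgn (@sgnZ R N k) i); @GQueryInv R N k K;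
      dgate (ctlsgn (@sgnP R N k) i);
      @GQuery R N k K; dgate (ctlsgn (@sgnZ R N k) i); @GQueryInv R N k K;
      dgate (ctlsgn (@sgnN R N k) i)].

Definition bstep i : seq gt :=
  [:: dgate (ctlsgn (@sgnN R N k) i);
      @GQuery R N k K; dgate (ctlsgn (@sgnZ R N k) i); @GQueryInv R N k K;
      dgate (ctlsgn (@sgnP R N k) i);
      @GQuery R N k K; dgate (ctlsgn (@sgnZ R N k) i); @GQueryInv R N k K].

Definition iterg (f : nat -> seq gt) n : seq gt := flatten [seq f i | i <- iota 0 n].

Lemma itergS f n : iterg f n.+1 = iterg f n ++ f n.
Proof. by rewrite /iterg -addn1 iotaD map_cat flatten_cat /= cats0. Qed.

Lemma iterg_ok f n : (forall i, gates_ok (f i)) -> gates_ok (iterg f n).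
Proof. by move=> h; elim: n => [//|n IH]; rewrite itergS; apply: gates_ok_cat. Qed.

Lemma iterg_count f c n : (forall i, count (@is_query R N k K) (f i) = c) ->
  count (@is_query R N k K) (iterg f n) = (n * c)%N.
Proof. by move=> h; elim: n => [//|n IH]; rewrite itergS count_cat IH h mulSn addnC. Qed.

Lemma ctlsgn_ok sg i : (forall o, sg o * sg o = 1) -> gate_ok (dgate (ctlsgn sg i)).
Proof. by move=> h; apply: dgate_ok => m o; rewrite /ctlsgn; case: ifP; rewrite ?mulr1. Qed.

Lemma fstep_ok i : gates_ok (fstep i).
Proof.
by do !split; apply: ctlsgn_ok; [exact: sgnZK | exact: sgnPK | exact: sgnZK | exact: sgnNK].
Qed.

Lemma bstep_ok i : gates_ok (bstep i).
Proof.
by do !split; apply: ctlsgn_ok; [exact: sgnNK | exact: sgnZK | exact: sgnPK | exact: sgnZK].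
Qed.

Definition RQ (tau : nat) (t : 'I_nT) (x y : X) : R :=
  if (tau < t)%N then (x.1 == y.1)%:R * (2 * Q x.2 y.2) - (x == y)%:R else (x == y)%:R.

Definition startR (x : X) : R := if isP x.1 then a else 0.

Definition RS (tau : nat) (t : 'I_nT) (x y : X) : R :=
  if (tau < t)%N then (x == y)%:R - 2 * startR x * startR y else (x == y)%:R.

(** Only the two reflections look at the clock: where they are skipped, the controlled walk and its
    inverse cancel. *)
Definition gstep tau : seq gt :=
  iterg fstep D ++ bgate (RQ tau) :: iterg bstep D ++ [:: bgate (RS tau)].

Definition vprep (s : S) : R := b * startR (s.1, (enum_val s.2).1).

Variable b0 : S.

(* Householder reflection exchanging the basis state [b0] and [vprep]. *)
Definition house (x y : S) : R :=
  (x == y)%:R - ((x == b0)%:R - vprep x) * ((y == b0)%:R - vprep y) / (1 - vprep b0).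

Definition hgate : gt := GUnitary (fun x y => (house x y)%:C%C).

(** Preparing [vprep], running the clocked Grover iterates and unpreparing makes the amplitude of
    [b0] the overlap of [vprep] with its evolution. *)
Definition test_stage : stage R N k :=
  @Stage R N k K b0 (hgate :: iterg gstep nT ++ [:: hgate]).

(** A Grover iterate makes [2 * D] walk steps of four queries each. *)
Lemma test_stage_queries : stage_queries test_stage = (nT * (8 * D))%N.
Proof.
rewrite /stage_queries /= count_cat /= addn0 add0n (@iterg_count _ (8 * D)%N) ?addn0 // => i.
rewrite /gstep count_cat /= count_cat /= addn0.
by rewrite !(@iterg_count _ 4) //; lia.
Qed.

Hypothesis Qsym : forall m m', Q m m' = Q m' m.
Hypothesis Qidem : forall m m', \sum_j Q m j * Q j m' = Q m m'.
Hypothesis a1 : a ^+ 2 * (N%:R * #|J|%:R) = 1.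
Hypothesis b1 : b ^+ 2 * nT%:R = 1.
Hypothesis vb0 : vprep b0 < 1.

Lemma sum_startR : \sum_x startR x * startR x = 1.
Proof.
rewrite -a1 (eq_bigr (fun x => startR (x.1, x.2) * startR (x.1, x.2))); last by case.
rewrite -(pair_bigA _ (fun o m => startR (o, m) * startR (o, m))) /=.
transitivity (\sum_(o : OT N k) (if isP o then (fun=> #|J|%:R * a ^+ 2) o.1.1 else 0)).
  apply: eq_bigr => o _; rewrite /startR /= sumr_const.
  case: ifP => _; last by rewrite mul0r mul0rn.
  by rewrite mulr_natl expr2; congr (_ *+ _); apply: eq_card.
rewrite [LHS](@sum_isP N k R (fun=> #|J|%:R * a ^+ 2)) sumr_const card_ord -mulr_natl.
by ring.
Qed.

Lemma sum_vprep : \sum_x vprep x * vprep x = 1.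
Proof.
rewrite sum_ST -b1 mulr_natr -[X in _ *+ X]card_ord -sumr_const; apply: eq_bigr => t _.
rewrite -[RHS]mulr1 -sum_startR mulr_sumr; apply: eq_bigr => -[o m] _.
by rewrite /vprep /= enum_rankK /=; ring.
Qed.

Lemma house_sym x y : house x y = house y x.
Proof. by rewrite /house eq_sym; ring. Qed.

Lemma house_idem x y : \sum_z house x z * house z y = (x == y)%:R.
Proof.
have nz : 1 - vprep b0 != 0 by rewrite subr_eq0 eq_sym lt_eqF.
pose u z := (z == b0)%:R - vprep z.
(* Both [b0] and [vprep] are unit vectors; with this norm, [house] is [1 - 2 u u^T / |u|^2]. *)
have uu : \sum_z u z * u z = 2 * (1 - vprep b0).
  transitivity (\sum_z ((z == b0)%:R * ((z == b0)%:R - 2 * vprep z) + vprep z * vprep z)).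
    by apply: eq_bigr => z _; rewrite /u; ring.
  by rewrite big_split /= sum_delta sum_vprep eqxx /=; ring.
have dd : \sum_z (x == z)%:R * (z == y)%:R = (x == y)%:R :> R by rewrite sum_delta_sym.
have e : forall z, house x z * house z y =
   (x == z)%:R * (z == y)%:R - (x == z)%:R * (u z * u y / (1 - vprep b0))
   - (z == y)%:R * (u x * u z / (1 - vprep b0))
   + u x * u y / (1 - vprep b0) ^+ 2 * (u z * u z).
  by move=> z; rewrite /house -!/(u _); field.
rewrite (eq_bigr _ (fun z _ => e z)) big_split /= !sumrB dd.
rewrite sum_delta_sym sum_delta -mulr_sumr uu; field.
exact: nz.
Qed.

Lemma house_b0 s : house b0 s = vprep s.
Proof.
have nz : 1 - vprep b0 != 0 by rewrite subr_eq0 eq_sym lt_eqF.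
by rewrite /house eqxx [b0 == s]eq_sym /=; field.
Qed.

Lemma hgate_ok : gate_ok hgate.
Proof. exact: unitary_real house_sym house_idem. Qed.

Lemma RQ_ok tau : gate_ok (bgate (RQ tau)).
Proof.
apply: bgate_ok => t x y; rewrite /RQ; case: (tau < t)%N; try by rewrite eq_sym.
- by rewrite Qsym (@eq_sym (OT N k) x.1) [x == y]eq_sym.
- pose q z z' : R := (z.1 == z'.1 :> OT N k)%:R * (2 * Q z.2 z'.2).
  have qq : \sum_z q x z * q z y = 2 * q x y.
    rewrite (eq_bigr (fun z => q x (z.1, z.2) * q (z.1, z.2) y)); last by case.
    rewrite -(pair_bigA _ (fun o m => q x (o, m) * q (o, m) y)) /q /=.
    rewrite (bigD1 x.1) //= [X in _ + X]big1 ?addr0 => [|o /negPf xo].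
      under eq_bigr do rewrite eqxx mul1r mulrCA -[2 * _ * _]mulrA.
      rewrite -!mulr_sumr; under eq_bigr do rewrite mulrCA.
      by rewrite -mulr_sumr Qidem; ring.
    by apply: big1 => m _; rewrite eq_sym xo !mul0r.
  transitivity (\sum_z (q x z * q z y - (z == y)%:R * q x z - (x == z)%:R * q z y + (x == z)%:R * (z == y)%:R)).
    by apply: eq_bigr => z _; rewrite -!/(q _ _); ring.
  by rewrite big_split /= !sumrB qq sum_delta !sum_delta_sym; ring.
- by rewrite sum_delta_sym.
Qed.

Lemma RS_ok tau : gate_ok (bgate (RS tau)).
Proof.
apply: bgate_ok => t x y; rewrite /RS; case: (tau < t)%N; try by rewrite eq_sym.
- by rewrite [x == y]eq_sym; ring.
- transitivity (\sum_z ((x == z)%:R * (z == y)%:R - (x == z)%:R * (2 * startR z * startR y)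
     - (z == y)%:R * (2 * startR x * startR z) + 4 * startR x * startR y * (startR z * startR z))).
    by apply: eq_bigr => z _; ring.
  by rewrite big_split /= !sumrB sum_delta !sum_delta_sym -mulr_sumr sum_startR; ring.
- by rewrite sum_delta_sym.
Qed.

Lemma gstep_ok tau : gates_ok (gstep tau).
Proof.
apply: gates_ok_cat; first exact: iterg_ok fstep_ok.
split; first exact: RQ_ok.
by apply: gates_ok_cat; [exact: iterg_ok bstep_ok | split; [exact: RS_ok|]].
Qed.

Lemma test_stage_ok : gates_ok (sgates test_stage).
Proof.
split; first exact: hgate_ok.
by apply: gates_ok_cat; [exact: iterg_ok gstep_ok | split; [exact: hgate_ok|]].
Qed.

(** * Semantics of the circuit *)

Section Semantics.
Variable O : op R (OT N k).
Hypothesis UO : unitary O.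
Hypothesis wD : forall m, (w m <= D)%N.

Lemma slice2_ctl sg i psi t m : slice2 (apply_gate O (dgate (ctlsgn sg i)) psi) t m =
  if (i < w m)%N then dgop sg (slice2 psi t m) else slice2 psi t m.
Proof.
rewrite slice2_dgate; apply: funext => o; rewrite /dgop /ctlsgn.
by case: ifP => // _; rewrite mul1r.
Qed.

Lemma slice2_fstep i psi t m : slice2 (run O (fstep i) psi) t m =
  if (i < w m)%N then walkF O (slice2 psi t m) else slice2 psi t m.
Proof.
rewrite /fstep !run_cons !(slice2_ctl, slice2_query, slice2_queryinv).
by case: (i < w m)%N => //; rewrite !mulop_adjK.
Qed.

Lemma slice2_bstep i psi t m : slice2 (run O (bstep i) psi) t m =
  if (i < w m)%N then walkB O (slice2 psi t m) else slice2 psi t m.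
Proof.
rewrite /bstep !run_cons !(slice2_ctl, slice2_query, slice2_queryinv).
by case: (i < w m)%N => //; rewrite !mulop_adjK.
Qed.

(** Step [i] acts on block [m] exactly when [i < w m]; as [w m <= D], the block receives [w m] steps
    in total. *)
Lemma slice_iterg (f : nat -> seq gt) (W : (OT N k -> C) -> (OT N k -> C)) psi t :
  (forall i psi t m, slice2 (run O (f i) psi) t m =
     if (i < w m)%N then W (slice2 psi t m) else slice2 psi t m) ->
  slice (run O (iterg f D) psi) t = fun x => iter (w x.2) W (slice2 psi t x.2) x.1.
Proof.
move=> hf; apply: funext => -[o m] /=; rewrite -[w m](minn_idPr (wD m)).
rewrite -[LHS]/(slice2 (run O (iterg f D) psi) t m o); congr (_ o).
elim: D => [|n IH]; first by rewrite min0n.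
rewrite itergS run_cat hf IH; case: ltnP => h.
  by rewrite (minn_idPl h).
by rewrite (minn_idPr (leqW h)).
Qed.

Lemma mulop_RQ tau t u : (tau < nat_of_ord t)%N ->
  mulop (fun x y => (RQ tau t x y)%:C%C) u = fun x => 2 * projQ Q u x + (-1) * u x.
Proof.
move=> h; apply: funext => x; rewrite /mulop /RQ h /projQ.
under eq_bigr do rewrite rmorphB mulrBl rmorph_nat.
rewrite sumrB sum_delta_sym mulN1r; congr (_ - _).
rewrite (eq_bigr (fun z => (x.1 == z.1)%:R * (2 * (Q x.2 z.2)%:C%C * u (z.1, z.2)))); last first.
  by move=> [o m] _ /=; rewrite !rmorphM !rmorph_nat /=; ring.
rewrite -(pair_bigA _ (fun o m => (x.1 == o)%:R * (2 * (Q x.2 m)%:C%C * u (o, m)))) /=.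
under eq_bigr do rewrite -mulr_sumr.
by rewrite sum_delta_sym mulr_sumr; apply: eq_bigr => m _; rewrite mulrA.
Qed.

Lemma startXE x : startX a x = (startR x)%:C%C.
Proof. by rewrite /startX /basisE /startR; case: ifP. Qed.

Lemma mulop_RS tau t u : (tau < nat_of_ord t)%N ->
  mulop (fun x y => (RS tau t x y)%:C%C) u =
  fun x => u x + (- 2 * ip (startX a) u) * startX a x.
Proof.
move=> h; apply: funext => x; rewrite /mulop /RS h.
under eq_bigr do rewrite rmorphB mulrBl rmorph_nat.
rewrite sumrB sum_delta_sym; congr (_ + _).
rewrite /ip mulr_sumr mulr_suml -sumrN; apply: eq_bigr => z _.
by rewrite !startXE conjc_real; ring.
Qed.

Lemma slice_gstep tau psi t : slice (run O (gstep tau) psi) t =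
  if (tau < t)%N then groverG O w Q a (slice psi t) else slice psi t.
Proof.
rewrite /gstep run_cat run_cons run_cat run_cons run_nil.
rewrite slice_bgate (slice_iterg _ _ slice2_bstep) /slice2.
rewrite slice_bgate (slice_iterg _ _ slice2_fstep) /slice2.
rewrite -[fun x => iter _ (walkF O) _ _]/(ctlF O w (slice psi t)).
case: ifP => h.
  rewrite mulop_RQ // mulop_RS //.
  set F := ctlB O w (fun x => 2 * projQ Q (ctlF O w (slice psi t)) x + (-1) * ctlF O w (slice psi t) x).
  rewrite -[LHS]/(fun x => F x + (- 2 * ip (startX a) F) * startX a x).
  (* Conjugating [2 Q - 1] by the controlled walk gives [2 goodB - 1]. *)
  by rewrite /F linop_ctlB ctlFK.
have id1 (H : 'I_nT -> X -> X -> R) u : (forall x y, H t x y = (x == y)%:R) ->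
    mulop (fun x y => (H t x y)%:C%C) u = u.
  move=> hH; rewrite -[RHS]mulop_delta; congr mulop; apply: funext => x.
  by apply: funext => y; rewrite hH rmorph_nat.
rewrite !id1; [exact: ctlFK | |] => x y; by rewrite /RQ /RS h.
Qed.

Lemma slice_iter_gstep psi t :
  slice (run O (iterg gstep nT) psi) t = iter t (groverG O w Q a) (slice psi t).
Proof.
rewrite -[X in iter X](minn_idPr (ltnW (ltn_ord t))).
elim: {1 2}nT => [|n IH]; first by rewrite min0n.
rewrite itergS run_cat slice_gstep IH; case: ltnP => h.
  by rewrite (minn_idPl h).
by rewrite (minn_idPr (leqW h)).
Qed.

Variable s : 'I_N -> R.
Hypothesis Us : forall be (o : OT N k), isP o -> queryU O (basisE be) o = (s o.1.1 * be o.1.1)%:C%C.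
Hypothesis s01 : forall x, 0 <= s x ^+ 2 <= 1.
Local Notation p := (goodp w Q a s).
Hypothesis p01 : 0 <= p <= 1.

(** Clock value [t] has received exactly [t] Grover iterates and contributes [b ^+ 2 * <s, G^t s>],
    with [b ^+ 2 = 1 / nT]. *)
Lemma test_stage_amp : @stage_state R N k O test_stage b0 =
  (nT%:R^-1 * \sum_(t < nT) complex.Re (rot p ^+ t))%:C%C.
Proof.
have nT0 : nT%:R != 0 :> R.
  by apply/eqP => h; move: b1; rewrite h mulr0 => /eqP; rewrite eq_sym oner_eq0.
rewrite -[LHS]/(run O (sgates test_stage) (fun t => (t == b0)%:R) b0).
rewrite /test_stage [sgates _]/= run_cons run_cat run_cons run_nil.
have -> : apply_gate O hgate (fun t => (t == b0)%:R) = (fun x => (vprep x)%:C%C).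
  apply: funext => x /=; under eq_bigr do rewrite mulrC.
  by rewrite sum_delta house_sym house_b0.
rewrite [LHS]/=; under eq_bigr do rewrite house_b0.
rewrite sum_ST mulr_sumr rmorph_sum; apply: eq_bigr => t _ /=.
transitivity (b%:C%C * ip (startX a) (slice (run O (iterg gstep nT) (fun x => (vprep x)%:C%C)) t)).
  rewrite /ip mulr_sumr; apply: eq_bigr => -[o m] _ /=.
  by rewrite /vprep /= enum_rankK /= startXE conjc_real rmorphM mulrA.
rewrite slice_iter_gstep.
have -> : slice (fun x => (vprep x)%:C%C) t = fun x => b%:C%C * startX a x + 0 * startX a x.
  by apply: funext => -[o m]; rewrite /slice /vprep /= enum_rankK /= startXE; ring.
rewrite (linop_iter _ (@linop_groverG _ _ _ O _ w Q a)) ip_comb.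
rewrite (ip_groverG UO Qidem Us s01 a1 _ p01) mul0r addr0 mulrA -rmorphM -rmorphM /=.
congr (_ * _)%:C%C; apply: (mulIf nT0); rewrite mulVf // -b1 expr2; ring.
Qed.

Lemma test_stage_prob : csq (@stage_state R N k O test_stage b0) =
  (nT%:R^-1 * \sum_(t < nT) complex.Re (rot p ^+ t)) ^+ 2.
Proof. by rewrite test_stage_amp csq_real. Qed.

Lemma run_csq gs psi : gates_ok gs -> \sum_t csq (run O gs psi t) = \sum_t csq (psi t).
Proof.
elim: gs psi => [//|g gs IH] psi [og ogs]; rewrite run_cons IH //.
apply: complexI; rewrite -!ip_csq.
have hk (A : op R (OT N k)) : unitary A -> forall phi : S -> C,
    ip (fun t : S => \sum_o A t.1 o * phi (o, t.2)) (fun t : S => \sum_o A t.1 o * phi (o, t.2))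
    = ip phi phi.
  by move=> UA phi; rewrite !ip_pair; apply: eq_bigr => i _; rewrite -[RHS](ip_unitary _ _ UA).
case: g og => [U /= UU||] *; [exact: ip_unitary| exact: hk |].
exact: (hk (adjop O) (adjop_unitary UO)).
Qed.

Lemma test_stage_total : \sum_t csq (@stage_state R N k O test_stage t) = 1.
Proof.
rewrite (run_csq _ test_stage_ok) (bigD1 b0) //= eqxx big1 ?addr0 => [|t /negPf ->].
  by rewrite (csq_real 1) expr1n.
exact: csq0.
Qed.

End Semantics.

End Circuit.

(** * Biased oracles *)

Section Oracle.
Variables (R : realType) (N k : nat) (f : 'I_N -> bool) (eps : R) (O : op R (OT N k)).
Hypothesis HO : biased_oracle f eps O.
Local Notation C := (complex R).

Let UO : unitary O. Proof. by case: HO. Qed.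

Definition in0 (x : 'I_N) : OT N k := (x, wzero k, false).

Definition bit_prob (x : 'I_N) (b : bool) : R := \sum_w csq (O (x, w, b) (in0 x)).

Definition osgn (x : 'I_N) : R := bit_prob x false - bit_prob x true.

Lemma oracle_supp x y w b : y != x -> O (y, w, b) (in0 x) = 0.
Proof.
move=> /negPf yx; case: HO => _ /(_ x)[al [be [wx [wx' [_ _ h _]]]]].
by rewrite /in0 h yx.
Qed.

Lemma sum_OT (V : nmodType) (F : OT N k -> V) :
  \sum_o F o = \sum_y (\sum_w F (y, w, false) + \sum_w F (y, w, true)).
Proof.
rewrite (eq_bigr (fun o => F (o.1, o.2))); last by case.
rewrite -(pair_bigA _ (fun p b => F (p, b))) /=.
rewrite (eq_bigr (fun p => F (p.1, p.2, true) + F (p.1, p.2, false))); last first.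
  by move=> [y w] _; rewrite big_bool.
rewrite -(pair_bigA _ (fun y w => F (y, w, true) + F (y, w, false))) /=.
by apply: eq_bigr => y _; rewrite big_split addrC.
Qed.

Lemma bit_prob_total x : bit_prob x false + bit_prob x true = 1.
Proof.
have := UO (in0 x) (in0 x); rewrite eqxx sum_OT (bigD1 x) //= [X in _ + X]big1 => [|y yx].
  rewrite addr0 => h; apply: complexI; rewrite rmorph1 -[RHS]h rmorphD /bit_prob !rmorph_sum.
  by congr (_ + _); apply: eq_bigr => w _; rewrite csq_conjM.
by rewrite !big1 ?addr0 // => w _; rewrite (oracle_supp _ _ yx) mulr0.
Qed.

(** The oracle preserves [x], so different [x] do not interfere, and the expectation of [Z] after
    [O|x,0,0>] is P(bit 0) - P(bit 1). *)
Lemma queryU_oracle (be : 'I_N -> R) (o : OT N k) : isP o ->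
  queryU O (basisE be) o = (osgn o.1.1 * be o.1.1)%:C%C.
Proof.
move: o => [[x w0] b0]; rewrite /isP /= => /andP[/eqP -> /negPf ->].
have Ov (t : OT N k) : mulop O (basisE be) t = O t (in0 t.1.1) * (be t.1.1)%:C%C.
  rewrite /mulop -(sum_delta_sym t.1.1 (fun y => O t (in0 y) * (be y)%:C%C)) -(@sum_isP N k).
  apply: eq_bigr => -[[y w] b] _; rewrite /basisE; case: ifP => //=; last by rewrite mulr0.
  rewrite /isP /= => /andP[/eqP -> /negPf ->].
  have [<-|ty] := eqVneq t.1.1 y; first by rewrite mul1r.
  by case: t ty => [[y' w'] b'] /= ty; rewrite oracle_supp // mul0r mul0r.
rewrite /queryU /mulop sum_OT (bigD1 x) //= [X in _ + X]big1 => [|y yx]; last first.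
  by rewrite !big1 ?addr0 // => w _; rewrite /adjop -/(in0 x) (oracle_supp _ _ yx) conjc0 mul0r.
rewrite addr0 /osgn mulrBl rmorphB !rmorphM /bit_prob !rmorph_sum -mulNr -sumrN !mulr_suml.
congr (_ + _); apply: eq_bigr => w _; rewrite /dgop /sgnZ -!/(mulop _ _ _) Ov /adjop -/(in0 x) /=.
  by rewrite -csq_conjM; ring.
by rewrite -csq_conjM; ring.
Qed.

Lemma eps_xE x : eps_x f O x = bit_prob x (f x) - 1 / 2.
Proof. by []. Qed.

Lemma bit_prob_ge0 x b : 0 <= bit_prob x b.
Proof. by apply: sumr_ge0 => w _; exact: csq_ge0. Qed.

(** The two bit probabilities are [1/2 + eps_x] and [1/2 - eps_x]; which is which depends on [f x],
    and squaring removes this sign. *)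
Lemma osgn2 x : osgn x ^+ 2 = 4 * eps_x f O x ^+ 2.
Proof.
have e : bit_prob x true = 1 - bit_prob x false by rewrite -(bit_prob_total x); ring.
by rewrite eps_xE /osgn e; case: (f x); rewrite ?e; field.
Qed.

Lemma eps_x_le x : eps_x f O x <= 1 / 2.
Proof.
rewrite eps_xE; have := bit_prob_total x; have := bit_prob_ge0 x (~~ f x).
by case: (f x) => /=; lra.
Qed.

Lemma eps_x_ge x : eps <= eps_x f O x.
Proof.
case: HO => _ /(_ x)[al [be [wx [wx' [nwx _ h hal]]]]].
have -> : eps_x f O x = csq al - 1 / 2.
  rewrite /eps_x; congr (_ - _); rewrite -[RHS]mulr1 -nwx mulr_sumr.
  apply: eq_bigr => w _; rewrite h !eqxx -csqM.
  by case: (f x); rewrite /= mulr1 mulr0 addr0.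
by lra.
Qed.

Hypotheses (N0 : (0 < N)%N) (eps0 : 0 < eps).

Lemma eps_min_le x : eps_min f O <= eps_x f O x.
Proof. exact: bigmin_le_cond. Qed.

Lemma eps_min_attained : exists x, eps_min f O = eps_x f O x.
Proof.
exists [arg min_(x < Ordinal N0) eps_x f O x]%O; apply: bigmin_eq_arg => // x _.
(* The default value 1 of the minimum lies above every [eps_x]. *)
by have := eps_x_le x; lra.
Qed.

Lemma eps_min_gt0 : 0 < eps_min f O.
Proof. by have [x ->] := eps_min_attained; apply: lt_le_trans (eps_x_ge x). Qed.

Lemma eps_min_le_half : eps_min f O <= 1 / 2.
Proof. by have [x ->] := eps_min_attained; apply: eps_x_le. Qed.

Lemma osgn2_bounds x : 0 <= osgn x ^+ 2 <= 1.
Proof.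
rewrite sqr_ge0 /= osgn2; have := eps_x_le x; have := eps_x_ge x => h1 h2.
have e0 : 0 <= eps_x f O x by apply: le_trans (ltW eps0) h1.
by move: (eps_x f O x) e0 h2 => e *; nra.
Qed.

End Oracle.

(** * Stopping probability of a level *)

Section TestBounds.
Variable R : realType.
Local Notation C := (complex R).
Implicit Types (p q : R).

Definition rotavg p n : R := n%:R^-1 * \sum_(t < n) complex.Re (rot p ^+ t).
(** Probability of finding a control register of size [n] back in the uniform state after it has
    driven the phase [rot p]. *)
Definition rotq p n : R := csq (\sum_(t < n) rot p ^+ t) / n%:R ^+ 2.

Lemma sqr_Re_le (z : C) : complex.Re z ^+ 2 <= csq z.
Proof. by rewrite /csq lerDl sqr_ge0. Qed.

(** By [csq_sum_rot] the squared mean is at most [1 / (p n^2)]. *)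
Lemma rotavg2_le p n : 0 <= p <= 1 -> 16 <= p * n%:R ^+ 2 -> rotavg p n ^+ 2 <= 1 / 16.
Proof.
move=> p01 pn; have n0 : 0 < n%:R :> R.
  rewrite ltr0n lt0n; apply/eqP => h; move: pn; rewrite h expr0n /= mulr0; lra.
have p0 : 0 < p by case/andP: p01 => p0 _; have := sqr_ge0 (n%:R : R); nra.
rewrite /rotavg -Re_sum exprMn exprVn mulrC ler_pdivrMr ?exprn_gt0 //.
have := sqr_Re_le (\sum_(t < n) rot p ^+ t); have := csq_sum_rot n p01.
set c := csq _; set r := complex.Re _ => h1 h2.
have h3 : p * r ^+ 2 <= 1 by nra.
rewrite -(ler_pM2l p0); nra.
Qed.

Lemma rotavg_ge p n : (0 < n)%N -> 0 <= p <= 1 -> 1 - 2 * (p * n%:R ^+ 2) <= rotavg p n.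
Proof.
move=> n0 p01; have n0' : 0 < n%:R :> R by rewrite ltr0n.
have /andP[p0 _] := p01.
rewrite /rotavg [leRHS]mulrC ler_pdivlMr // mulr_natr -[X in _ *+ X]card_ord -sumr_const.
apply: ler_sum => t _; apply: le_trans (Re_rotX t p01).
rewrite lerD2l lerN2 -mulrA ler_pM2l // ler_wpM2l // lerXn2r ?nnegrE ?ler0n // ler_nat.
exact: ltnW.
Qed.

(** The mean is at least [31 / 32], and [(31 / 32)^2 >= 15 / 16]. *)
Lemma rotavg2_ge p n : (0 < n)%N -> 0 <= p <= 1 -> p * n%:R ^+ 2 <= 1 / 64 ->
  15 / 16 <= rotavg p n ^+ 2.
Proof. by move=> n0 p01 h; have := rotavg_ge n0 p01; set r := rotavg _ _ => h'; nra. Qed.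

Lemma rotavg2_bounds p n : (0 < n)%N -> 0 <= p <= 1 -> 0 <= rotavg p n ^+ 2 <= 1.
Proof.
move=> n0 p01; have n0' : 0 < n%:R :> R by rewrite ltr0n.
rewrite sqr_ge0 /= -real_normK ?num_real // exprn_ile1 ?normr_ge0 // /rotavg.
rewrite normrM normfV (ger0_norm (ler0n _ n)) mulrC ler_pdivrMr // mul1r.
apply: le_trans (ler_norm_sum _ _ _) _.
rewrite -[X in _ <= X%:R]card_ord -sumr_const; apply: ler_sum => t _.
by rewrite ler_norml Re_csq_le // csqX csq_rot // expr1n.
Qed.

Lemma rotq_le1 p n : 0 <= p <= 1 -> rotq p n <= 1.
Proof.
move=> p01; case: n => [|n]; first by rewrite /rotq big_ord0 csq0 mul0r ler01.
rewrite /rotq ler_pdivrMr ?exprn_gt0 ?ltr0n // mul1r.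
rewrite -lecR csqE rmorphXn rmorph_nat /= lerXn2r ?nnegrE ?normr_ge0 ?ler0n //.
apply: le_trans (ler_norm_sum _ _ _) _.
rewrite -[X in _ <= X%:R]card_ord -sumr_const; apply: ler_sum => t _.
by rewrite normrX (csq_1_norm (csq_rot p01)) expr1n.
Qed.

Lemma rotq_ge0 p n : 0 <= rotq p n.
Proof. by rewrite divr_ge0 ?csq_ge0 ?exprn_ge0 ?ler0n. Qed.

Lemma rotq_small p n : 0 <= p <= 1 -> 16 <= p * n%:R ^+ 2 -> rotq p n <= 1 / 16.
Proof.
move=> p01 pn; have n0 : 0 < n%:R :> R.
  rewrite ltr0n lt0n; apply/eqP => h; move: pn; rewrite h expr0n /= mulr0; lra.
have p0 : 0 < p by case/andP: p01 => p0 _; have := sqr_ge0 (n%:R : R); nra.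
rewrite /rotq ler_pdivrMr ?exprn_gt0 // -(ler_pM2l p0).
by have := csq_sum_rot n p01; nra.
Qed.

Lemma rotq_large p n : (0 < n)%N -> 0 <= p <= 1 -> p * n%:R ^+ 2 <= 1 / 25 ->
  21 / 25 <= rotq p n.
Proof.
move=> n0 p01 h; have := rotavg_ge n0 p01; rewrite /rotavg /rotq -Re_sum => h1.
have n0' : 0 < n%:R :> R by rewrite ltr0n.
have := sqr_Re_le (\sum_(t < n) rot p ^+ t); set c := csq _; set r := complex.Re _ in h1 * => h2.
rewrite ler_pdivlMr ?exprn_gt0 //; apply: le_trans h2.
(* From [1 - 2 / 25]; the square [529 / 625] exceeds [21 / 25]. *)
have h3 : 23 / 25 * n%:R <= r by rewrite -ler_pdivlMr // [_ / _]mulrC; lra.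
by nra.
Qed.

Lemma majpoly_small L q : 0 <= q -> q <= 1 / 16 -> majpoly L q <= (1 / 2) ^+ L.
Proof.
move=> q0 q1; have q01 : 0 <= q <= 1 by lra.
(* At [z = 4] the base is [1/4 + 15 q / 4], at most [31 / 64]. *)
apply: le_trans (@majpoly_le _ L q 4 q01 _) _; first by lra.
by rewrite lerXn2r ?nnegrE //; lra.
Qed.

Lemma majpoly_large L q : (3 <= L)%N -> q <= 1 -> 21 / 25 <= q -> 1 / 2 <= majpoly L q.
Proof.
move=> L3 q1 q2; have q01 : 0 <= q <= 1 by lra.
(* At [z = 2] the base is [2 - 3 q / 2], at most [37 / 50]; three registers bring the failure below
   [27 / 64]. *)
apply: le_trans (@majpoly_ge _ L q 2 q01 _); last by lra.
have : ((1 - q) * 2 + q / 2) ^+ L <= (3 / 4) ^+ L by rewrite lerXn2r ?nnegrE //; lra.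
have : (3 / 4) ^+ L <= (3 / 4) ^+ 3 :> R by rewrite ler_wiXn2l //; lra.
have -> : (3 / 4) ^+ 3 = 27 / 64 :> R by field.
lra.
Qed.

End TestBounds.

(** * The test of one level, with its parameters fixed *)

Section Level.
Variables (R : realType) (N' k j : nat).
Local Notation N := N'.+1.
Local Notation C := (complex R).

(** Chosen so that [N * 2^(-reps) <= 2^(-14)], see [stop_prob_no]. *)
Definition reps : nat := trunc_log 2 N + 15.
Definition horizon : nat := 6 * (Num.truncn (Num.sqrt N%:R : R)).+1.
Local Notation J := {ffun 'I_reps -> 'I_(2 ^ j)}.

Definition amp_a : R := (Num.sqrt (N%:R * #|{: J}|%:R))^-1.
Definition amp_b : R := (Num.sqrt horizon%:R)^-1.

Lemma horizon_gt0 : (0 < horizon)%N. Proof. by []. Qed.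

(* The answer qubit is 1, so that this state is orthogonal to [vprep] and the Householder
   reflection does not degenerate. *)
Definition level_b0 : ST N k #|{: J * 'I_horizon}| :=
  ((ord0, wzero k, true), enum_rank ([ffun=> wzero j], Ordinal horizon_gt0)).

Definition level_stage : stage R N k :=
  test_stage (@wt reps (2 ^ j)) (@majproj R reps (2 ^ j)) amp_a amp_b (reps * 2 ^ j) level_b0.

Lemma card_J : #|{: J}| = ((2 ^ j) ^ reps)%N.
Proof. by rewrite card_ffun !card_ord. Qed.

Lemma amp_a1 : amp_a ^+ 2 * (N%:R * #|{: J}|%:R) = 1.
Proof.
rewrite exprVn sqr_sqrtr ?mulr_ge0 ?ler0n // mulVf //.
by rewrite mulf_neq0 ?pnatr_eq0 // card_J expn_eq0 expn_eq0.
Qed.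

Lemma amp_b1 : amp_b ^+ 2 * horizon%:R = 1.
Proof. by rewrite exprVn sqr_sqrtr ?ler0n // mulVf // pnatr_eq0. Qed.

Lemma level_vb0 : vprep amp_a amp_b level_b0 < 1.
Proof. by rewrite /vprep /startR /isP /= ?andbF mulr0 ltr01. Qed.

Let M0 : (0 < 2 ^ j)%N := pow2_gt0 j.

Lemma level_stage_ok : gates_ok (sgates level_stage).
Proof.
apply: test_stage_ok; [exact: majproj_sym | | exact: amp_a1 | exact: amp_b1 | exact: level_vb0].
by move=> m m'; apply: majproj_idem.
Qed.

Lemma level_stage_queries : stage_queries level_stage = (horizon * (8 * (reps * 2 ^ j)))%N.
Proof. exact: test_stage_queries. Qed.

Variables (f : 'I_N -> bool) (eps : R) (O : op R (OT N k)).
Hypotheses (eps0 : 0 < eps) (HO : biased_oracle f eps O).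
Local Notation em := (eps_min f O).
Local Notation s := (osgn O).

Definition stop_prob : R := csq (@stage_state R N k O level_stage level_b0).

Definition good_prob : R := N%:R^-1 * \sum_x majpoly reps (rotq (s x ^+ 2) (2 ^ j)).

Let UO : unitary O. Proof. by case: HO. Qed.
Let s01 : forall x, 0 <= s x ^+ 2 <= 1. Proof. exact: osgn2_bounds HO eps0. Qed.

Lemma good_probE :
  goodp (@wt reps (2 ^ j)) (@majproj R reps (2 ^ j)) amp_a s = good_prob.
Proof.
have M0' : (2 ^ j)%:R ^+ reps != 0 :> R by rewrite expf_neq0 // pnatr_eq0 -lt0n.
rewrite /goodp /good_prob !mulr_sumr; apply: eq_bigr => x _.
rewrite majproj_form ?csq_rot // -/(rotq _ _) /= mulrA; congr (_ * _).
apply: (mulIf (_ : N%:R != 0)); first by rewrite pnatr_eq0.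
(* The factor [M ^ L] of [majproj_form] is the number of control states and cancels in the
   normalization [amp_a]. *)
by rewrite mulVf ?pnatr_eq0 // -[RHS]amp_a1 card_J !natrX -mulrA (mulrC N%:R).
Qed.

Let h x : 0 <= majpoly reps (rotq (s x ^+ 2) (2 ^ j)) <= 1.
Proof. by apply: majpoly_bounds; rewrite rotq_ge0 rotq_le1. Qed.

Lemma good_prob_bounds : 0 <= good_prob <= 1.
Proof.
apply/andP; split.
  rewrite mulr_ge0 ?invr_ge0 ?ler0n //; apply: sumr_ge0 => x _.
  by case/andP: (h x).
rewrite /good_prob mulrC ler_pdivrMr ?ltr0n // mul1r -[X in _ <= X%:R]card_ord -sumr_const.
by apply: ler_sum => x _; case/andP: (h x).
Qed.

Lemma stop_probE : stop_prob = rotavg good_prob horizon ^+ 2.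
Proof.
have Qi (m m' : J) : \sum_i majproj R m i * majproj R i m' = majproj R m m'.
  exact: majproj_idem.
have := test_stage_prob Qi amp_a1 amp_b1 level_vb0 UO (@wt_le _ _) (queryU_oracle HO) s01.
by rewrite good_probE; apply; exact: good_prob_bounds.
Qed.

Lemma level_total : \sum_t csq (@stage_state R N k O level_stage t) = 1.
Proof.
apply: test_stage_total => //; [exact: majproj_sym | | exact: amp_a1 | exact: amp_b1 | exact: level_vb0].
by move=> m m'; apply: majproj_idem.
Qed.

Lemma horizon_bounds : 36 * N%:R <= horizon%:R ^+ 2 :> R /\ horizon%:R <= 12 * Num.sqrt N%:R :> R.
Proof.
set r := Num.sqrt (N%:R : R).
have r0 : 1 <= r by rewrite -(sqrtr1 R) ler_sqrt ?ltr0n // ler1n.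
have rr : r ^+ 2 = N%:R by rewrite sqr_sqrtr ?ler0n.
have /andP[h1 h2] : (Num.truncn r)%:R <= r < (Num.truncn r).+1%:R by rewrite truncn_itv //; lra.
rewrite /horizon natrM -/r; move: h2; rewrite -natr1; set n := _%:R in h1 * => h2.
by rewrite -rr; split; nra.
Qed.

Lemma stop_prob_ge0 : 0 <= stop_prob. Proof. exact: csq_ge0. Qed.

Lemma stop_prob_le1 : stop_prob <= 1.
Proof.
by rewrite stop_probE; case/andP: (rotavg2_bounds horizon_gt0 good_prob_bounds).
Qed.

(** The minimizing [x] alone gives flagged weight at least [1 / (2 N)], and the squared horizon is
    at least [36 N]: the product 18 exceeds the threshold 16 of [rotavg2_le]. At this [x],
    [s^2 M^2 <= 4 / 100] is the threshold of [rotq_large]. *)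
Lemma stop_prob_yes : em * (10 * (2 ^ j)%:R) <= 1 -> stop_prob <= 1 / 16.
Proof.
move=> hem; rewrite stop_probE; apply: rotavg2_le; first exact: good_prob_bounds.
have [x ex] := eps_min_attained HO isT.
have hx : 1 / 2 <= majpoly reps (rotq (s x ^+ 2) (2 ^ j)).
  apply: majpoly_large; [by rewrite /reps addnC | exact: rotq_le1 | apply: rotq_large => //].
  rewrite (osgn2 HO) -ex; have := eps_min_gt0 HO isT eps0.
  move: em hem => e; have : 0 <= (2 ^ j)%:R :> R := ler0n _ _; move: (2 ^ j)%:R => m h0 h1 h2.
  have h3 : 0 <= e * m by rewrite mulr_ge0 // ltW.
  by rewrite -mulrA -exprMn; nra.
have hp : 1 / 2 <= N%:R * good_prob.
  rewrite /good_prob mulVKf ?pnatr_eq0 // (bigD1 x) //=.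
  by apply: ler_wpDr => //; apply: sumr_ge0 => y _; case/andP: (h y).
by have [hT _] := horizon_bounds; have /andP[p0 _] := good_prob_bounds; nra.
Qed.

(** Here [s^2 M^2 >= 16] for every [x], so the flagged weight is at most [2^(-reps)]; times a
    squared horizon of at most [144 N] this is at most [144 / 2^14 < 1 / 64]. *)
Lemma stop_prob_no : 2 <= em * (2 ^ j)%:R -> 15 / 16 <= stop_prob.
Proof.
move=> hem; rewrite stop_probE; apply: rotavg2_ge; [by [] | exact: good_prob_bounds |].
have hx x : majpoly reps (rotq (s x ^+ 2) (2 ^ j)) <= (1 / 2) ^+ reps.
  apply: majpoly_small; [exact: rotq_ge0 | apply: rotq_small => //].
  rewrite (osgn2 HO); have := eps_min_le f O x.
  have := eps_min_gt0 HO isT eps0; have : 0 <= (2 ^ j)%:R :> R := ler0n _ _.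
  move: em (eps_x f O x) (2 ^ j)%:R hem => e e' m h1 h2 h3 h4.
  have h5 : 2 <= e' * m by apply: le_trans h1 _; rewrite ler_wpM2r.
  by rewrite -mulrA -exprMn; nra.
have hp : good_prob <= (1 / 2) ^+ reps.
  rewrite /good_prob mulrC ler_pdivrMr ?ltr0n // mulr_natr -[X in _ *+ X]card_ord -sumr_const.
  by apply: ler_sum => x _; exact: hx.
have hL : N%:R * (1 / 2) ^+ reps <= (1 / 2) ^+ 14 :> R.
  have h14 : 0 <= (1 / 2) ^+ 14 :> R by rewrite exprn_ge0 //; lra.
  (* Split [reps] as [(trunc_log 2 N + 1) + 14]; the first power of two exceeds [N]. *)
  rewrite /reps addnS -addSn exprD mulrA ler_piMl // mul1r exprVn.
  rewrite ler_pdivrMr ?exprn_gt0 // mul1r -natrX ler_nat.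
  exact: ltnW (trunc_log_ltn _ _).
have e7 : (1 / 2) ^+ 7 = 1 / 128 :> R by field.
have [_ hT] := horizon_bounds; have hT0 : 0 <= horizon%:R :> R by rewrite ler0n.
have hT2 : horizon%:R ^+ 2 <= 144 * N%:R :> R.
  rewrite -[N%:R in leRHS](@sqr_sqrtr _ N%:R) ?ler0n //.
  by have := sqrtr_ge0 (N%:R : R); nra.
have /andP[p0 _] := good_prob_bounds.
apply: le_trans (_ : good_prob * (144 * N%:R) <= _); first by rewrite ler_wpM2l.
apply: le_trans (_ : (1 / 2) ^+ reps * (144 * N%:R) <= _); first by rewrite ler_wpM2r // mulr_ge0 ?ler0n.
by move: hL; rewrite (exprD _ 7 7) e7; move: (_ ^+ reps) => z; lra.
Qed.

End Level.

(** * The adaptive search as a Markov chain *)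

Section Chain.
Variable R : realType.

(* [LRun j X Y]: level [j], after [X] tests voting to stop and [Y] voting to continue. *)
Inductive lstate : Type := LHalt of R | LRun of nat & nat & nat.

Definition runs (j : nat) : nat := 6 * (trunc_log 2 j.+1).+1.

Definition outval (j : nat) : R := (10 * (2 ^ j)%:R)^-1.

Definition after (j X Y : nat) : lstate :=
  if (X + Y < runs j)%N then LRun j X Y
  else if (Y <= X)%N then LHalt (outval j) else LRun j.+1 0 0.

Definition nextst (j X Y : nat) (b : bool) : lstate :=
  if b then after j X.+1 Y else after j X Y.+1.

Variables (p cost : nat -> R) (P : R -> bool).

Fixpoint chain_prob (n : nat) (s : lstate) : R :=
  match s with
  | LHalt r => (P r)%:R
  | LRun j X Y => if n is m.+1 then
      p j * chain_prob m (nextst j X Y true) + (1 - p j) * chain_prob m (nextst j X Y false)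
    else 0
  end.

Fixpoint chain_cost (n : nat) (s : lstate) : R :=
  if n is m.+1 then
    match s with
    | LHalt _ => 0
    | LRun j X Y => cost j +
       (p j * chain_cost m (nextst j X Y true) + (1 - p j) * chain_cost m (nextst j X Y false))
    end
  else 0.

Lemma runs_mono i j : (i <= j)%N -> (runs i <= runs j)%N.
Proof. by move=> ij; rewrite leq_mul2l /= ltnS leq_trunc_log. Qed.

Lemma runsS j : (runs j.+1 <= 2 * runs j)%N.
Proof.
rewrite /runs mulnCA leq_mul2l /=; have h : (trunc_log 2 j.+2 <= (trunc_log 2 j.+1).+1)%N.
  rewrite -ltnS -(ltn_exp2l _ _ (isT : 1 < 2)%N).
  apply: leq_ltn_trans (trunc_logP _ _) _ => //.
  have := @trunc_log_ltn 2 j.+1 isT; rewrite [(2 ^ _.+2)%N]expnS; lia.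
lia.
Qed.

(** Six tests gain a factor [2^(-4)], and [2 ^ (trunc_log 2 j.+1 + 1) >= j + 2]. The fourth power
    makes the errors summable over the levels. *)
Lemma theta_runs j : (5 / 8) ^+ runs j <= ((j.+2)%:R ^+ 4)^-1 :> R.
Proof.
have h6 : (5 / 8) ^+ 6 <= (2 ^+ 4)^-1 :> R.
  have h3 : (5 / 8) ^+ 3 <= 1 / 4 :> R.
    have -> : (5 / 8) ^+ 3 = 125 / 512 :> R by field.
    by lra.
  have -> : (2 ^+ 4)^-1 = (1 / 4) ^+ 2 :> R by field.
  have h0 : 0 <= (5 / 8) ^+ 3 :> R by rewrite exprn_ge0 //; lra.
  by rewrite (exprM _ 3 2) lerXn2r ?nnegrE //; lra.
rewrite /runs exprM; apply: (@le_trans _ _ ((2 ^+ 4)^-1 ^+ (trunc_log 2 j.+1).+1)).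
  by rewrite lerXn2r ?nnegrE ?exprn_ge0 ?invr_ge0 ?exprn_ge0 //; lra.
rewrite exprVn lef_pV2 ?posrE ?exprn_gt0 ?ltr0n // -exprM mulnC exprM.
rewrite lerXn2r ?nnegrE ?exprn_ge0 ?ler0n // -natrX ler_nat.
exact: trunc_log_ltn.
Qed.

(* Chernoff weight: if each test votes to stop with probability at most 1/16, then
   [8^(X-Y) (5/8)^(runs j - X - Y)] is a supermartingale, as [8/16 + (15/16)/8 <= 5/8]. *)
Definition wgt (j X Y : nat) : R := 8 ^+ X / 8 ^+ Y * (5 / 8) ^+ (runs j - (X + Y)).

Lemma wgt_ge0 j X Y : 0 <= wgt j X Y.
Proof. by rewrite mulr_ge0 ?exprn_ge0 ?divr_ge0 ?exprn_ge0 //; lra. Qed.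

(** A vote to stop brings a factor 8 and uses up one of the factors [5 / 8] in reserve. *)
Lemma wgtSl j X Y : (X + Y < runs j)%N -> wgt j X.+1 Y = 64 / 5 * wgt j X Y.
Proof.
move=> h; rewrite /wgt -(ltn_predK h) addSn subSS subSn; last by lia.
rewrite !exprS; move: (_ ^+ (_ - _)) => z; have : (8 ^+ Y : R) != 0 by rewrite expf_neq0.
by move: (8 ^+ X) (8 ^+ Y) => x y y0; field.
Qed.

Lemma wgtSr j X Y : (X + Y < runs j)%N -> wgt j X Y.+1 = 1 / 5 * wgt j X Y.
Proof.
move=> h; rewrite /wgt -(ltn_predK h) addnS subSS subSn; last by lia.
rewrite !exprS; move: (_ ^+ (_ - _)) => z; have : (8 ^+ Y : R) != 0 by rewrite expf_neq0.
by move: (8 ^+ X) (8 ^+ Y) => x y y0; field.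
Qed.

Lemma wgt_end j X Y : (runs j <= X + Y)%N -> (Y <= X)%N -> 1 <= wgt j X Y.
Proof.
move=> h YX; rewrite /wgt (eqP (h : _ - _ == 0)%N) mulr1 ler_pdivlMr ?exprn_gt0 // mul1r.
by rewrite ler_weXn2l //; lra.
Qed.

Lemma wgt00 j : wgt j 0 0 = (5 / 8) ^+ runs j.
Proof. by rewrite /wgt !expr0 divr1 mul1r subn0. Qed.

Definition valid (s : lstate) : bool :=
  if s is LRun j X Y then (X + Y < runs j)%N else true.

Lemma valid_after j X Y : valid (after j X Y).
Proof. by rewrite /after; case: ifP => //; case: ifP. Qed.

Lemma valid_next j X Y b : valid (nextst j X Y b).
Proof. by case: b; exact: valid_after. Qed.

Hypothesis p01 : forall j, 0 <= p j <= 1.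
(** In the application [J] is the least level with [eps_min * 2 ^ J >= 2]. Just below it a test may
    be inconclusive, but there the output is already correct. *)
Variables (J : nat) (c0 : R).
Hypothesis J0 : (0 < J)%N.
Hypothesis p_lo : forall j, (j < J)%N -> p j <= 1 / 16 \/ P (outval j).
Hypothesis p_hi : forall j, (J <= j)%N -> 15 / 16 <= p j.
Hypothesis PJ : P (outval J).
Hypothesis c01 : 1 <= c0.
Hypothesis costE : forall j, cost j = c0 * 2 ^+ j.

Let c00 : 0 <= c0. Proof. by have := c01; lra. Qed.

(** Error budget of the levels after [j]: the decrease of [1 / (8 (j + 2))] pays for each new level
    below [J], the constant [1 / 8] for level [J]. *)
Definition errK (j : nat) : R := 1 / 8 + 1 / 8 * (j.+2)%:R^-1.

(* Supermartingale bounding the probability of a wrong output. *)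
Definition err (s : lstate) : R :=
  match s with
  | LHalt r => (~~ P r)%:R
  | LRun j X Y =>
      if (j < J)%N then (if p j <= 1 / 16 then wgt j X Y else 0) + errK j
      else if j == J then wgt j Y X else 1
  end.

Lemma errK_ge0 j : 0 <= errK j.
Proof. by rewrite addr_ge0 ?mulr_ge0 ?invr_ge0 ?ler0n //; lra. Qed.

Lemma err_ge0 s : 0 <= err s.
Proof.
case: s => [r|j X Y] /=; first by rewrite ler0n.
case: ifP => _; last by case: ifP => _; rewrite ?wgt_ge0.
by rewrite addr_ge0 ?errK_ge0 //; case: ifP => _; rewrite ?wgt_ge0.
Qed.

Lemma theta_le16 j : (5 / 8) ^+ runs j <= 1 / 16 :> R.
Proof.
apply: le_trans (theta_runs j) _.
have -> : 1 / 16 = (2 ^+ 4)^-1 :> R by field.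
rewrite lef_pV2 ?posrE ?exprn_gt0 ?ltr0n // lerXn2r ?nnegrE ?ler0n //.
by rewrite ler_nat.
Qed.

Lemma err_enter j : (j < J)%N -> err (LRun j.+1 0 0) <= errK j.
Proof.
move=> jJ /=; rewrite wgt00; case: ltnP => h; last first.
  have -> : j.+1 = J by apply/eqP; rewrite eqn_leq jJ.
  rewrite eqxx; apply: le_trans (theta_le16 J) _; rewrite /errK.
  have : 0 <= j.+2%:R^-1 :> R by rewrite invr_ge0.
  by move: (j.+2%:R^-1) => z z0; lra.
have h1 : (5 / 8) ^+ runs j.+1 + errK j.+1 <= errK j.
  rewrite /errK addrCA lerD2l -lerBrDr -mulrBr; apply: le_trans (theta_runs _) _.
  have : 0 < j%:R + 1 :> R by rewrite ltr_wpDl.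
  rewrite -[j.+3%:R]natr1 -[j.+2%:R]natr1 -[j.+1%:R]natr1; move: (j%:R + 1) => x x0.
  have -> : 1 / 8 * ((x + 1)^-1 - (x + 1 + 1)^-1) = (8 * ((x + 1) * (x + 1 + 1)))^-1.
    by field; apply/andP; split; lra.
  rewrite lef_pV2 ?posrE; [nra | by rewrite exprn_gt0 //; lra|].
  by rewrite !mulr_gt0 //; lra.
case: ifP => _; first exact: h1.
by rewrite add0r; apply: le_trans h1; rewrite lerDr exprn_ge0 //; lra.
Qed.

Lemma err_after_lo j X Y : (j < J)%N -> p j <= 1 / 16 ->
  err (after j X Y) <= wgt j X Y + errK j.
Proof.
move=> jJ pj; rewrite /after; case: ltnP => h; first by rewrite /= jJ pj.
case: leqP => YX.
  apply: le_trans (_ : 1 <= _); first by rewrite /= lern1 leq_b1.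
  by have := wgt_end h YX; have := errK_ge0 j; lra.
by apply: le_trans (err_enter jJ) _; rewrite lerDr wgt_ge0.
Qed.

(** At an inconclusive level stopping is correct and moving on only needs the budget [errK j]. *)
Lemma err_after_mid j X Y : (j < J)%N -> ~~ (p j <= 1 / 16) -> err (after j X Y) <= errK j.
Proof.
move=> jJ pj; rewrite /after; case: ltnP => h; first by rewrite /= jJ (negPf pj) add0r.
case: leqP => YX; last exact: err_enter.
by case: (p_lo jJ) => [pj'|/= ->]; [rewrite pj' in pj | exact: errK_ge0].
Qed.

(** Leaving [J] upwards counts as an error, so the rare event is now a majority to continue: the
    roles of [X] and [Y] in the weight are exchanged. *)
Lemma err_after_J X Y : err (after J X Y) <= wgt J Y X.
Proof.
rewrite /after; case: ltnP => h; first by rewrite /= ltnn eqxx.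
case: leqP => YX; first by rewrite /= PJ wgt_ge0.
by rewrite /= ltnNge leqnSn /= gtn_eqF // wgt_end 1?addnC // ltnW.
Qed.

Lemma err_le1_hi j X Y : (J < j)%N -> err (LRun j X Y) = 1.
Proof. by move=> h; rewrite /= ltnNge (ltnW h) /= gtn_eqF. Qed.

Lemma err_after_hi j X Y : (J < j)%N -> err (after j X Y) <= 1.
Proof.
move=> h; rewrite /after; case: ltnP => h'; first by rewrite err_le1_hi.
case: leqP => _; first by rewrite /= lern1 leq_b1.
by rewrite err_le1_hi // ltnW.
Qed.

Lemma err_step j X Y : valid (LRun j X Y) ->
  p j * err (nextst j X Y true) + (1 - p j) * err (nextst j X Y false) <= err (LRun j X Y).
Proof.
rewrite /valid => h; have /andP[p0 p1] := p01 j; have p1' : 0 <= 1 - p j by lra.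
(* [A] and [B] bound the two successors whether or not the level ends there. *)
suff [A [B [hA hB hAB]]] : exists A B, [/\ err (after j X.+1 Y) <= A, err (after j X Y.+1) <= B &
    p j * A + (1 - p j) * B <= err (LRun j X Y)].
  by apply: le_trans hAB; rewrite lerD // ler_wpM2l.
have [jJ|Jj|jJ] := ltngtP j J.
- have [pj|pj] := boolP (p j <= 1 / 16).
    exists (wgt j X.+1 Y + errK j), (wgt j X Y.+1 + errK j).
    split; [exact: err_after_lo | exact: err_after_lo |].
    rewrite /= jJ pj wgtSl // wgtSr //.
    (* The mean growth factor [(64 p + (1 - p)) / 5] is at most 1 when [p <= 4 / 63]. *)
    by have := wgt_ge0 j X Y; move: (wgt j X Y) (errK j) => w e w0; nra.
  exists (errK j), (errK j); split; [exact: err_after_mid | exact: err_after_mid |].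
  by rewrite /= jJ (negPf pj) add0r; lra.
- by exists 1, 1; split; [exact: err_after_hi | exact: err_after_hi | rewrite err_le1_hi //; lra].
- subst j; exists (wgt J Y X.+1), (wgt J Y.+1 X).
  split; [exact: err_after_J | exact: err_after_J |].
  rewrite /= ltnn eqxx wgtSl 1?addnC // wgtSr 1?addnC //.
  by have := p_hi (leqnn J); have := wgt_ge0 J Y X; move: (wgt J Y X) => w w0; nra.
Qed.

(** The terms are [1 / 16] for level 0 and [errK 0 = 3 / 16]. *)
Lemma err_init : err (LRun 0 0 0) <= 1 / 4.
Proof.
rewrite /= J0 wgt00; have := theta_le16 0; rewrite /errK.
have : 0 <= (5 / 8) ^+ runs 0 :> R by rewrite exprn_ge0 //; lra.
by case: ifP => _; lra.
Qed.

(** Upper bounds for the cost from level [j] on. For [potU], the levels from [j] to [J - 1] cost at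
    most [c0 * runs J * (2^J - 2^j)], and [3 * 2^J] in place of the bracket covers the rest; [potF],
    for [j >= J], is twice the cost of level [j]. *)
Definition potU (j : nat) : R := c0 * (runs J)%:R * (4 * 2 ^+ J - 2 ^+ j).
Definition potF (j : nat) : R := 2 * c0 * (runs j)%:R * 2 ^+ j.

(* Bounds the expected remaining cost. *)
Definition pot (s : lstate) : R :=
  match s with
  | LHalt _ => 0
  | LRun j X Y => (runs j - (X + Y))%:R * cost j +
      (if (j < J)%N then potU j.+1 else wgt j Y X * potF j.+1)
  end.

Lemma potU_ge0 j : (j <= J)%N -> 0 <= potU j.
Proof.
move=> jJ; rewrite !mulr_ge0 ?ler0n //.
have : 2 ^+ j <= 2 ^+ J :> R by rewrite ler_weXn2l //; lra.
have : 0 < 2 ^+ J :> R by rewrite exprn_gt0.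
lra.
Qed.

Lemma potF_ge0 j : 0 <= potF j.
Proof. by rewrite !mulr_ge0 ?ler0n ?exprn_ge0 //. Qed.

Lemma cost_ge0 j : 0 <= cost j.
Proof. by rewrite costE mulr_ge0 ?exprn_ge0. Qed.

Lemma pot_ge0 s : 0 <= pot s.
Proof.
case: s => [r|j X Y] //=; rewrite addr_ge0 ?mulr_ge0 ?ler0n ?cost_ge0 //.
by case: ifP => h; [exact: potU_ge0 | rewrite mulr_ge0 ?wgt_ge0 ?potF_ge0].
Qed.

(** [potF] grows at most fourfold per level, while the next level is charged with weight at most
    [1 / 16]: the continuation costs at most a quarter of [potF j], and level [j] itself half. *)
Lemma pot_enterF j : (J <= j)%N -> pot (LRun j 0 0) <= potF j.
Proof.
move=> Jj; rewrite /= ltnNge Jj /= wgt00 subn0 costE /potF exprS.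
have h1 := theta_le16 j; have h2 : (runs j.+1)%:R <= 2 * (runs j)%:R :> R.
  by rewrite -natrM ler_nat runsS.
have h3 : 0 <= (5 / 8) ^+ runs j :> R by rewrite exprn_ge0 //; lra.
have h4 : 0 <= (runs j.+1)%:R :> R by [].
have h5 : 0 <= c0 * 2 ^+ j by rewrite mulr_ge0 ?exprn_ge0.
have h6 : (5 / 8) ^+ runs j * (runs j.+1)%:R <= 1 / 8 * (runs j)%:R :> R.
  apply: le_trans (_ : 1 / 16 * (2 * (runs j)%:R) <= _); last by lra.
  by rewrite ler_pM.
have -> : (5 / 8) ^+ runs j * (2 * c0 * (runs j.+1)%:R * (2 * 2 ^+ j)) =
  4 * ((5 / 8) ^+ runs j * (runs j.+1)%:R) * (c0 * 2 ^+ j) by ring.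
rewrite (_ : 2 * c0 * _ * _ = 2 * (runs j)%:R * (c0 * 2 ^+ j)); last by ring.
rewrite -mulrDl ler_wpM2r //; have : 0 <= (runs j)%:R :> R by [].
lra.
Qed.

(** Below [J], [potU] drops by [c0 * runs J * 2^j], enough for level [j] since [runs] is monotone;
    at [J], three units of [potU] cover two of [potF]. *)
Lemma pot_enterU j : (j <= J)%N -> pot (LRun j 0 0) <= potU j.
Proof.
rewrite leq_eqVlt => /predU1P[->|jJ].
  apply: le_trans (pot_enterF (leqnn J)) _; rewrite /potF /potU.
  rewrite (_ : 4 * _ - _ = 3 * 2 ^+ J); last by ring.
  rewrite (_ : 2 * c0 * _ * _ = c0 * (runs J)%:R * (2 * 2 ^+ J)); last by ring.
    rewrite ler_wpM2l ?mulr_ge0 ?ler0n //.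
  by rewrite ler_wpM2r ?exprn_ge0 //; lra.
rewrite /= jJ subn0 costE /potU exprS.
have h : (runs j)%:R <= (runs J)%:R :> R by rewrite ler_nat runs_mono // ltnW.
have h5 : 0 <= c0 * 2 ^+ j by rewrite mulr_ge0 ?exprn_ge0.
rewrite -subr_ge0 (_ : _ - _ = ((runs J)%:R - (runs j)%:R) * (c0 * 2 ^+ j)); last by ring.
by rewrite mulr_ge0 // subr_ge0.
Qed.

Lemma pot_after_lo j X Y : (j < J)%N ->
  pot (after j X Y) <= (runs j - (X + Y))%:R * cost j + potU j.+1.
Proof.
move=> jJ; rewrite /after; case: ltnP => h; first by rewrite /= jJ.
have h1 : 0 <= (runs j - (X + Y))%:R * cost j by rewrite mulr_ge0 ?ler0n ?cost_ge0.
case: leqP => _; first by rewrite addr_ge0 ?potU_ge0.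
by apply: le_trans (pot_enterU jJ) _; rewrite lerDr.
Qed.

Lemma pot_after_hi j X Y : (J <= j)%N ->
  pot (after j X Y) <= (runs j - (X + Y))%:R * cost j + wgt j Y X * potF j.+1.
Proof.
move=> jJ; rewrite /after; case: ltnP => h; first by rewrite /= ltnNge jJ.
have h1 : 0 <= (runs j - (X + Y))%:R * cost j by rewrite mulr_ge0 ?ler0n ?cost_ge0.
case: leqP => YX; first by rewrite addr_ge0 // mulr_ge0 ?wgt_ge0 ?potF_ge0.
apply: le_trans (pot_enterF (leqW jJ)) _; apply: ler_wpDl => //.
by rewrite ler_peMl ?potF_ge0 // wgt_end 1?addnC // ltnW.
Qed.

Lemma pot_step j X Y : valid (LRun j X Y) ->
  cost j + (p j * pot (nextst j X Y true) + (1 - p j) * pot (nextst j X Y false))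
  <= pot (LRun j X Y).
Proof.
rewrite /valid => h; have /andP[p0 p1] := p01 j; have p1' : 0 <= 1 - p j by lra.
suff [A [B [hA hB hAB]]] : exists A B, [/\ pot (after j X.+1 Y) <= A, pot (after j X Y.+1) <= B &
    cost j + (p j * A + (1 - p j) * B) <= pot (LRun j X Y)].
  by apply: le_trans hAB; rewrite lerD2l lerD // ler_wpM2l.
have e : (runs j - (X + Y))%:R = 1 + (runs j - (X + Y).+1)%:R :> R.
  by rewrite -(subnSK h) -natr1 addrC.
have [jJ|Jj] := ltnP j J.
  exists ((runs j - (X + Y).+1)%:R * cost j + potU j.+1), ((runs j - (X + Y).+1)%:R * cost j + potU j.+1).
  split; [by rewrite -addSn; exact: pot_after_lo | by rewrite -addnS; exact: pot_after_lo |].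
  by rewrite /= jJ e; move: (_%:R) (cost j) (potU _) => x y z; lra.
exists ((runs j - (X + Y).+1)%:R * cost j + wgt j Y X.+1 * potF j.+1),
       ((runs j - (X + Y).+1)%:R * cost j + wgt j Y.+1 X * potF j.+1).
split; [by rewrite -addSn; exact: pot_after_hi | by rewrite -addnS; exact: pot_after_hi |].
rewrite /= ltnNge Jj /= e wgtSl 1?addnC // wgtSr 1?addnC //.
have hp : 0 <= p j - 15 / 16 by rewrite subr_ge0 p_hi.
have w0 := mulr_ge0 (wgt_ge0 j Y X) (potF_ge0 j.+1); have := mulr_ge0 hp w0.
rewrite -!(mulrA _ (wgt j Y X)) [(1 + _) * cost j]mulrDl mul1r.
move: (p j) (cost j) (_%:R * cost j) (wgt j Y X * _) w0 => t c x w w0.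
by lra.
Qed.

Lemma chain_cost_le n s : valid s -> chain_cost n s <= pot s.
Proof.
elim: n s => [|n IH] s vs /=; first exact: pot_ge0.
case: s vs => [r|j X Y] vs //; apply: le_trans (pot_step vs).
have /andP[p0 p1] := p01 j; have p1' : 0 <= 1 - p j by lra.
by rewrite lerD2l lerD // ler_wpM2l // IH // valid_after.
Qed.

Lemma chain_prob_ge0 n s : 0 <= chain_prob n s.
Proof.
elim: n s => [|n IH] [r|j X Y] //=; have /andP[p0 p1] := p01 j.
by rewrite addr_ge0 // mulr_ge0 // subr_ge0.
Qed.

(* Markov's inequality: [pot] bounds the expected number of steps, so [pot s / n] bounds
   the probability of not having halted within [n] steps. *)
Lemma chain_prob_ge n s : valid s -> n%:R * (1 - err s - chain_prob n s) <= pot s.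
Proof.
elim: n s => [|n IH] s vs; first by rewrite mul0r pot_ge0.
case: s vs => [r|j X Y] vs /=.
  by case: (P r) => /=; rewrite ?subr0 ?subrr ?sub0r ?mulr0 ?oppr0 ?subrr ?mulr0.
have /andP[p0 p1] := p01 j; have p1' : 0 <= 1 - p j by lra.
(* Every step costs at least 1, so the expected cost dominates the expected number of steps. *)
have cj : 1 <= cost j.
  rewrite costE; apply: le_trans c01 _; rewrite ler_peMr //.
  by rewrite exprn_ege1 //; lra.
have := err_step vs; have := pot_step vs; have := err_ge0 (LRun j X Y).
have := IH _ (valid_next j X Y true); have := IH _ (valid_next j X Y false).
have := chain_prob_ge0 n (nextst j X Y true); have := chain_prob_ge0 n (nextst j X Y false).
rewrite -/(err (LRun j X Y)) -/(pot (LRun j X Y)) -natr1.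
move: (err (LRun j X Y)) (pot (LRun j X Y)) => E V.
move: (err (nextst j X Y true)) (err (nextst j X Y false)) => e1 e2.
move: (pot (nextst j X Y true)) (pot (nextst j X Y false)) => v1 v2.
move: (chain_prob n (nextst j X Y true)) (chain_prob n (nextst j X Y false)) => q1 q2.
have : 0 <= n%:R :> R := ler0n _ _; move: (n%:R) (cost j) (p j) cj p0 p1 p1' => m c t cj t0 t1 t1' hm hq2 hq1 h2 h1 hE hV he.
have hQ : 0 <= t * q1 + (1 - t) * q2 by rewrite addr_ge0 // mulr_ge0.
set Q := t * q1 + _ in hQ *.
have hD : 1 - E - Q <= t * (1 - e1 - q1) + (1 - t) * (1 - e2 - q2) by rewrite /Q; lra.
have := ler_wpM2l t0 h1; have := ler_wpM2l t1' h2; have := ler_wpM2l hm hD.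
by move: hV hE; nra.
Qed.

End Chain.

(** * The search algorithm and its reduction to the chain *)

Section Algorithm.
Variables (R : realType) (N' k : nat).
Local Notation N := N'.+1.

Definition lstep (s : lstate R) (n : nat) : lstate R :=
  match s with
  | LHalt r => s
  | LRun j X Y => nextst R j X Y (n == enum_rank (level_b0 R N' k j))
  end.

Definition search : algorithm R N k := fun h =>
  match foldl lstep (@LRun R 0 0 0) h with
  | LHalt r => Halt N k r
  | LRun j _ _ => Run (level_stage R N' k j)
  end.

Lemma search_ok : algorithm_ok search.
Proof.
move=> h; rewrite /search; case: (foldl _ _ h) => [r|j X Y] //.
exact: level_stage_ok.
Qed.

Definition level_cost (j : nat) : R := (stage_queries (level_stage R N' k j))%:R.

Variables (f : 'I_N -> bool) (eps : R) (O : op R (OT N k)).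
Hypotheses (eps0 : 0 < eps) (HO : biased_oracle f eps O).
Local Notation p := (fun j => stop_prob j O).

(** Only whether the outcome is [level_b0] matters, so all others merge into one vote to
    continue. *)
Lemma outcome_split j (F : bool -> R) :
  \sum_t csq (@stage_state R N k O (level_stage R N' k j) t) *
     F (nat_of_ord (enum_rank t) == enum_rank (level_b0 R N' k j)) =
  stop_prob j O * F true + (1 - stop_prob j O) * F false.
Proof.
rewrite (bigD1 (level_b0 R N' k j)) //= eqxx; congr (_ + _).
rewrite -(level_total j HO) [in RHS](bigD1 (level_b0 R N' k j)) //= addrAC subrr add0r.
rewrite mulr_suml; apply: eq_bigr => t tb; congr (_ * F _).
by apply: negbTE; apply: contra tb => /eqP/ord_inj/enum_rank_inj ->.
Qed.

Lemma halt_prob_chain P n h :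
  halt_prob search O P n h = chain_prob p P n (foldl lstep (@LRun R 0 0 0) h).
Proof.
elim: n h => [|n IH] h; rewrite /= /search; case E : (foldl _ _ h) => [r|j X Y] //=.
rewrite -(outcome_split j (fun b => chain_prob p P n (nextst R j X Y b))).
by apply: eq_bigr => t _; rewrite IH foldl_rcons E.
Qed.

Lemma queries_upto_chain n h :
  queries_upto search O n h = chain_cost p level_cost n (foldl lstep (@LRun R 0 0 0) h).
Proof.
elim: n h => [|n IH] h //=; rewrite /search; case E : (foldl _ _ h) => [r|j X Y] //=.
rewrite -(outcome_split j (fun b => chain_cost p level_cost n (nextst R j X Y b))).
by congr (_ + _); apply: eq_bigr => t _; rewrite IH foldl_rcons E.
Qed.

Local Notation em := (eps_min f O).

Definition base_cost : R := (horizon R N' * (8 * reps N'))%:R.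

Lemma level_costE j : level_cost j = base_cost * 2 ^+ j.
Proof.
rewrite /level_cost level_stage_queries /base_cost -natrX -natrM; congr _%:R.
by rewrite !mulnA.
Qed.

Lemma base_cost_ge1 : 1 <= base_cost.
Proof. by rewrite /base_cost ler1n !muln_gt0 /reps addnS. Qed.

Hypothesis pi8 : 8 <= pi ^+ 2 :> R.

Definition success (r : R) : bool := (em / (5 * pi ^+ 2) <= r) && (r <= em).

(** The lower bound needs [10 * eps_min * 2^j <= 5 * pi^2], which [10 * 4 = 5 * 8] and [pi^2 >= 8]
    provide. *)
Lemma success_out j : 1 <= em * (10 * (2 ^ j)%:R) -> em * (2 ^ j)%:R <= 4 ->
  success (outval R j).
Proof.
have e0 := eps_min_gt0 HO isT eps0.
have : 0 < (2 ^ j)%:R :> R by rewrite ltr0n pow2_gt0.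
rewrite /success /outval; move: (2 ^ j)%:R => m m0 h1 h2.
have m10 : 0 < 10 * m by lra.
apply/andP; split; last by rewrite -div1r ler_pdivrMr.
have h5 := pi8; rewrite ler_pdivrMr; last by lra.
by rewrite mulrC ler_pdivlMr //; lra.
Qed.

Lemma search_analysis : exists J : nat, [/\ 2 ^+ J <= 4 / em,
  (forall n, queries_upto search O n [::] <= 4 * base_cost * (runs J)%:R * 2 ^+ J) &
  exists n, 2 / 3 <= halt_prob search O success n [::]].
Proof.
have e0 := eps_min_gt0 HO isT eps0; have e1 := eps_min_le_half HO isT.
have ex : exists j, 2 <= em * (2 ^ j)%:R.
  (* Any integer [t > 2 / em] works, since [t < 2 ^ t]. *)
  exists (Num.truncn (2 / em)).+1; rewrite -ler_pdivrMl // mulrC.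
  have h := truncnS_gt (2 / em); set t := (Num.truncn (2 / em)).+1 in h *.
  have h2 : t%:R <= (2 ^ t)%:R :> R by rewrite ler_nat ltnW // ltn_expl.
  exact: ltW (lt_le_trans h h2).
case: (ex_minnP ex) => J hJ minJ; exists J.
have Jlt j : (j < J)%N -> em * (2 ^ j)%:R < 2.
  by move=> jJ; rewrite ltNge; apply/negP => /minJ; rewrite leqNgt jJ.
have J0 : (0 < J)%N by rewrite lt0n; apply/eqP => J0; move: hJ; rewrite J0 mulr1; lra.
(* Minimality gives a value below 2 at level [J - 1], and one level doubles it. *)
have hJ4 : em * (2 ^ J)%:R <= 4.
  have := Jlt J.-1; rewrite ltn_predL J0 => /(_ isT).
  by rewrite -[in (2 ^ J)%N](prednK J0) expnS natrM; lra.
have sp01 j : 0 <= stop_prob j O <= 1 by rewrite stop_prob_ge0 (stop_prob_le1 j eps0 HO).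
have slo j : (j < J)%N -> stop_prob j O <= 1 / 16 \/ success (outval R j).
  move=> jJ; have [h|h] := leP (em * (10 * (2 ^ j)%:R)) 1.
    by left; apply: stop_prob_yes HO h.
  by right; apply: success_out; [exact: ltW | have := Jlt _ jJ; lra].
have shi j : (J <= j)%N -> 15 / 16 <= stop_prob j O.
  move=> Jj; apply: (stop_prob_no eps0 HO); apply: le_trans hJ _.
  by rewrite ler_wpM2l ?(ltW e0) // ler_nat leq_exp2l.
have sJ : success (outval R J) by apply: success_out; lra.
have v0 : valid (@LRun R 0 0 0) by [].
have hpot : pot level_cost J base_cost (@LRun R 0 0 0) <= 4 * base_cost * (runs J)%:R * 2 ^+ J.
  apply: le_trans (pot_enterU base_cost_ge1 level_costE (leq0n J)) _.
  have : 0 <= base_cost * (runs J)%:R by rewrite mulr_ge0 ?ler0n.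
  by rewrite /potU expr0; move: base_cost (runs J)%:R (2 ^+ J) => b r m br; lra.
split.
- by rewrite ler_pdivlMr // mulrC -natrX.
- move=> n; rewrite queries_upto_chain; apply: le_trans hpot.
  exact: (chain_cost_le sp01 shi base_cost_ge1 level_costE).
(* With more than [12 V] steps, not halting has probability below [1 / 12], and
   [1 - 1/4 - 1/12 = 2/3]. *)
set V := pot _ _ _ _ in hpot; exists (Num.truncn (12 * V)).+1.
rewrite halt_prob_chain; set n := (Num.truncn (12 * V)).+1.
have := chain_prob_ge sp01 slo shi sJ base_cost_ge1 level_costE n v0.
have := err_init (fun j => stop_prob j O) success J0.
rewrite -/V; have hn : 12 * V < n%:R := truncnS_gt _.
have n0 : 0 < n%:R :> R by rewrite ltr0n.
move: (err _ _ _ _) (chain_prob _ _ _ _) => e q h1 h2.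
nra.
Qed.

End Algorithm.

(** * Numerical estimates *)

Section Numeric.
Import numFieldNormedType.Exports.
Variable R : realType.

Lemma sin_le (x : R) : 0 <= x -> sin x <= x.
Proof.
move=> x0.
have hd (y : R) : y \in `]0, x[ -> is_derive y 1 (@sin R) (cos y) by move=> _; exact: is_derive_sin.
have hc := @continuous_subspaceT R R `[0, x]%classic _ (@continuous_sin R).
have [c _] := MVT_segment x0 hd hc.
by rewrite sin0 !subr0 => ->; rewrite ler_piMl // cos_le1.
Qed.

(** Compare [sin (pi / 4) ^ 2 = 1 / 2] with [(pi / 4) ^ 2]. *)
Lemma sqr_pi_ge8 : 8 <= pi ^+ 2 :> R.
Proof.
have p0 := @pi_ge0 R; have q0 : 0 <= pi / 4 :> R by rewrite divr_ge0.
have s0 : 0 <= sin (pi / 4 : R).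
  by apply: sin_ge0_pi; rewrite q0 ler_pdivrMr // ler_peMr //; lra.
have := sin_le q0.
have : sin (pi / 4 : R) ^+ 2 = 1 / 2.
  have := cos_mulr2n (pi / 4 : R); have := cos2Dsin2 (pi / 4 : R).
  have -> : (pi / 4) *+ 2 = pi / 2 :> R by rewrite -mulr_natr; field.
  by rewrite cos_pihalf -mulr_natr; lra.
by move: (sin _) s0 => s s0 h1 h2; nra.
Qed.

Lemma ln2_ge : 1 / 2 <= ln 2 :> R.
Proof.
rewrite -ler_expR lnK ?posrE //; have h := @expR_ge1Dx R (- (1 / 2)).
have e : expR (1 / 2) * expR (- (1 / 2)) = 1 :> R by rewrite -expRD subrr expR0.
by have := expR_gt0 (1 / 2 : R); move: (expR _) (expR _) e h => x y e h x0; nra.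
Qed.

Lemma pow2_le_ln (x : R) n : 2 ^+ n <= x -> n%:R <= 2 * ln x.
Proof.
move=> h; have x0 : 0 < x by apply: lt_le_trans h; rewrite exprn_gt0.
have : ln (2 ^+ n) <= ln x by rewrite ler_ln ?posrE ?exprn_gt0.
rewrite lnXn // -[ln 2 *+ n]mulr_natl; have := ler_wpM2l (ler0n R n) ln2_ge; lra.
Qed.

Lemma ln_le_max (x : R) : 1 / 2 <= x -> ln (5 + 2 * x) <= 12 * Num.max 1 (ln x).
Proof.
move=> hx; have x0 : 0 < x by lra.
have h1 : ln (5 + 2 * x) <= ln (12 * x) by rewrite ler_ln ?posrE; lra.
have h2 : ln (12 * x) = ln 12 + ln x by rewrite lnM ?posrE.
have h3 : ln 12 <= 11 :> R.
  by have := @le_ln1Dx R 11; rewrite (_ : 1 + 11 = 12 :> R); [apply; lra | lra].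
have h4 : 1 <= Num.max 1 (ln x) by rewrite le_max lexx.
have h5 : ln x <= Num.max 1 (ln x) by rewrite le_max lexx orbT.
lra.
Qed.

(** [J] is logarithmic in [1 / x], and [runs] takes one more logarithm. The constant is
    [6 * (2 * 12 + 1)]. *)
Lemma runs_le (x : R) J : 0 < x <= 1 / 2 -> 2 ^+ J <= 4 / x ->
  (runs J)%:R <= 150 * Num.max 1 (ln (ln (1 / x))).
Proof.
move=> /andP[x0 x1] hJ; set y := ln (1 / x).
have x2 : 2 <= 1 / x by rewrite ler_pdivlMr //; lra.
have y0 : 1 / 2 <= y by apply: le_trans ln2_ge _; rewrite ler_ln ?posrE //; lra.
have hJ1 : J%:R <= 2 * (2 + y).
  apply: le_trans (pow2_le_ln hJ) _; rewrite ler_wpM2l //.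
  rewrite (_ : 4 / x = (1 + 1) * ((1 + 1) * (1 / x))); last by field; rewrite gt_eqF.
  have h1 : ln (1 + 1) <= 1 :> R by apply: le_ln1Dx; lra.
  have p2 : 0 < 1 + 1 :> R by lra.
  have px : 0 < 1 / x by rewrite divr_gt0.
  have p3 : 0 < (1 + 1) * (1 / x) by rewrite mulr_gt0.
  rewrite lnM ?posrE // lnM ?posrE // -/y.
  by move: (ln (1 + 1)) h1 => z h1; lra.
have ht : 2 ^+ trunc_log 2 J.+1 <= 5 + 2 * y.
  apply: (@le_trans _ _ (J.+1)%:R); first by rewrite -natrX ler_nat trunc_logP.
  by rewrite -[J.+1%:R]natr1; clearbody y; lra.
have h1 : 1 <= Num.max 1 (ln y) by rewrite le_max lexx.
have := pow2_le_ln ht; have := ln_le_max y0.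
rewrite /runs natrM -[(trunc_log 2 J.+1).+1%:R]natr1.
move: (trunc_log 2 J.+1)%:R (Num.max 1 (ln y)) (ln (5 + 2 * y)) h1 => a b c *; lra.
Qed.

Lemma reps_le N' : (reps N')%:R <= 17 * Num.max 1 (ln (N'.+1)%:R) :> R.
Proof.
have h : 2 ^+ trunc_log 2 N'.+1 <= (N'.+1)%:R :> R by rewrite -natrX ler_nat trunc_logP //.
have h1 : 1 <= Num.max 1 (ln (N'.+1)%:R) :> R by rewrite le_max lexx.
have h2 : ln (N'.+1)%:R <= Num.max 1 (ln (N'.+1)%:R) :> R by rewrite le_max lexx orbT.
by have := pow2_le_ln h; rewrite /reps natrD; move: (_%:R) (ln _) (Num.max _ _) h1 h2 => a b c *; lra.
Qed.

End Numeric.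

(** * All problem sizes, and the final query bound *)

Definition search_all (R : realType) (N k : nat) : algorithm R N k :=
  match N with
  | 0 => fun _ => Halt 0 k 0
  | N'.+1 => @search R N' k
  end.

(** The constant collects 4 from the potential, 12 from the horizon, 8 queries per unit of walk
    length, 17 from [reps], 150 from [runs] and 4 from [2 ^ J <= 4 / em]. *)
Lemma search_cost_le (R : realType) N' k (f : 'I_N'.+1 -> bool) (O : op R (OT N'.+1 k)) J :
  let em := eps_min f O in
  0 < em <= 1 / 2 -> 2 ^+ J <= 4 / em ->
  4 * base_cost R N' * (runs J)%:R * 2 ^+ J <=
  (4 * (12 * (8 * 17)) * 150 * 4) * (Num.sqrt (N'.+1)%:R * Num.max 1 (ln (N'.+1)%:R)) / em
    * Num.max 1 (ln (ln (1 / em))).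
Proof.
move=> em /andP[e0 e1] hJ; have he : 0 < em <= 1 / 2 by rewrite e0.
have h1 := runs_le he hJ; have h2 := @reps_le R N'; have [_ h3] := @horizon_bounds R N'.
have m1 : 0 <= Num.max 1 (ln (N'.+1)%:R) :> R by rewrite le_max ler01.
have m2 : 0 <= Num.max 1 (ln (ln (1 / em))) :> R by rewrite le_max ler01.
have s0 := sqrtr_ge0 ((N'.+1)%:R : R).
have b0 : base_cost R N' <= 12 * Num.sqrt (N'.+1)%:R * (8 * (17 * Num.max 1 (ln (N'.+1)%:R))).
  rewrite /base_cost (natrM _ (horizon R N')) (natrM _ 8).
  by apply: ler_pM; rewrite ?mulr_ge0 ?ler0n // ler_wpM2l ?ler0n.
have r0 : base_cost R N' * (runs J)%:R <=
    12 * Num.sqrt (N'.+1)%:R * (8 * (17 * Num.max 1 (ln (N'.+1)%:R))) *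
    (150 * Num.max 1 (ln (ln (1 / em)))) by rewrite ler_pM ?ler0n.
have t0 : base_cost R N' * (runs J)%:R * 2 ^+ J <=
    12 * Num.sqrt (N'.+1)%:R * (8 * (17 * Num.max 1 (ln (N'.+1)%:R))) *
    (150 * Num.max 1 (ln (ln (1 / em)))) * (4 / em).
  by rewrite ler_pM ?mulr_ge0 ?ler0n ?exprn_ge0.
have := ler_wpM2l (ler0n R 4) t0; rewrite !mulrA => t1.
apply: le_trans t1 _; rewrite le_eqVlt; apply/orP; left; apply/eqP.
by field; rewrite gt_eqF.
Qed.

Theorem theorem4 (R : realType) :
  exists (A : forall N k : nat, algorithm R N k),
    (forall N k, algorithm_ok (A N k)) /\
    exists c : R, 0 < c /\
    forall (N k : nat) (f : 'I_N -> bool) (eps : R) (O : op R (OT N k)),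
      (0 < N)%N -> 0 < eps -> biased_oracle f eps O ->
      let em := eps_min f O in
      ((2 / 3)%:E <= success_prob (A N k) O
          (fun r => (em / (5 * pi ^+ 2) <= r) && (r <= em))%R)%E /\
      (expected_queries (A N k) O <=
         (c * (Num.sqrt (N%:R) * Num.max 1 (ln (N%:R))) / em
            * Num.max 1 (ln (ln (1 / em))))%:E)%E.
Proof.
exists (search_all R); split; first by case=> [|N'] k; [move=> h | exact: search_ok].
exists (4 * (12 * (8 * 17)) * 150 * 4); split; first by rewrite !mulr_gt0.
move=> [|N'] k f eps O // _ eps0 HO em.
have [J [hJ hq [n hn]]] := search_analysis eps0 HO (sqr_pi_ge8 R).
have he : 0 < em <= 1 / 2 by rewrite (eps_min_gt0 HO isT eps0) (eps_min_le_half HO isT).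
split.
  by apply: le_ereal_sup_tmp; exists (halt_prob (search_all R N'.+1 k) O (success f O) n [::])%:E;
    [exists n | rewrite lee_fin].
apply: ge_ereal_sup => _ [m _ <-]; rewrite lee_fin.
exact: le_trans (hq m) (search_cost_le he hJ).
Qed.
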